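(* Let $H \leq G$ be one-ended groups such that $\tilde{e}(G,H) \geq 2$. If the almost malnormal closure $K$ of $H$ in $G$ is not equal to $G$, then $G$ splits (as a non-trivial amalgamated free product or an HNN extension) over a subgroup of $K$.
   Context: For a group $G$ and subgroup $H$, let $\mathcal{P}G$ be the power set of $G$, an $\mathbb{F}_2$-vector space under symmetric difference and an $\mathbb{F}_2 G$-module via translation by $G$; let $\mathcal{F}_H(G)=\{A\subseteq G : A\subseteq HF \text{ for some finite } F\subseteq G\}$, a submodule. The algebraic end invariant is $\tilde{e}(G,H)=\dim_{\mathbb{F}_2}\big(\mathcal{P}G/\mathcal{F}_H(G)\big)^G$. A subgroup $K\le G$ is almost malnormal if $K\cap gKg^{-1}$ is finite for every $g\in G\setminus K$; the almost malnormal closure of $H$ in $G$ is the intersection of all almost malnormal subgroups of $G$ containing $H$. A group splits over a subgroup $C$ if it is a non-trivial amalgam $A*_C B$ ($A\neq C\neq B$) or an HNN extension $A*_C$. *)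

(* Defs.v *)
From Stdlib Require Import List Bool Arith.
Import ListNotations.

Record group := Group {
  gcar :> Type;
  gmul : gcar -> gcar -> gcar;
  gone : gcar;
  ginv : gcar -> gcar;
  gmulA : forall x y z, gmul x (gmul y z) = gmul (gmul x y) z;
  gmul1g : forall x, gmul gone x = x;
  gmulg1 : forall x, gmul x gone = x;
  gmulVg : forall x, gmul (ginv x) x = gone;
  gmulgV : forall x, gmul x (ginv x) = gone
}.

Arguments gmul {g}.
Arguments gone {g}.
Arguments ginv {g}.

Section Defs.
Variable G : group.
Local Notation "x * y" := (gmul x y).
Local Notation "x ^-1" := (ginv x) (at level 2, left associativity).

Definition is_subgroup (P : G -> Prop) : Prop :=
  P gone /\ (forall x y, P x -> P y -> P (x * y)) /\ (forall x, P x -> P (x^-1)).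

Definition finite_set (P : G -> Prop) : Prop :=
  exists L : list G, forall x, P x -> In x L.

Inductive gen (P : G -> Prop) : G -> Prop :=
| gen1 : gen P gone
| genM : forall x y, P x -> gen P y -> gen P (x * y)
| genV : forall x y, P x -> gen P y -> gen P (x^-1 * y).

Inductive reach (S K : list G) (x : G) : G -> Prop :=
| reach0 : reach S K x x
| reachR : forall y s, reach S K x y -> In s S -> ~ In (y * s) K ->
             reach S K x (y * s)
| reachL : forall y s, reach S K x y -> In s S -> ~ In (y * s^-1) K ->
             reach S K x (y * s^-1).

(* The subgroup P is one-ended: it is finitely generated (by S), infinite,
   and for every finite set K of vertices, the complement of K in the
   Cayley graph Cay(P,S) has at most one (hence exactly one) infinite
   connected component. *)
Definition one_ended (P : G -> Prop) : Prop :=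
  exists S : list G,
    (forall s, In s S -> P s) /\
    (forall x, P x -> gen (fun s => In s S) x) /\
    ~ finite_set P /\
    forall (K : list G) (x y : G),
      P x -> P y -> ~ In x K -> ~ In y K ->
      ~ finite_set (reach S K x) -> ~ finite_set (reach S K y) ->
      reach S K x y.

(* elements of P G are boolean-valued functions; addition = symmetric difference *)
Definition symdiff (A B : G -> bool) : G -> bool := fun x => xorb (A x) (B x).

(* G acts on P G by (right) translation: A.g = { a * g | a in A } *)
Definition rtrans (A : G -> bool) (g : G) : G -> bool := fun x => A (x * g^-1).

Definition FH (H : G -> Prop) (A : G -> bool) : Prop :=
  exists F : list G, forall x, A x = true ->
    exists h f, H h /\ In f F /\ x = h * f.

(* A represents a G-fixed element of P G / F_H(G) *)
Definition invariant_class (H : G -> Prop) (A : G -> bool) : Prop :=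
  forall g, FH H (symdiff A (rtrans A g)).

Fixpoint lincomb (c : nat -> bool) (As : nat -> G -> bool) (n : nat) : G -> bool :=
  match n with
  | O => fun _ => false
  | S k => fun x => xorb (c k && As k x) (lincomb c As k x)
  end.

(* ~e(G,H) >= n : (P G / F_H(G))^G contains n F_2-linearly independent
   elements *)
Definition etilde_ge (H : G -> Prop) (n : nat) : Prop :=
  exists As : nat -> G -> bool,
    (forall i, i < n -> invariant_class H (As i)) /\
    forall c : nat -> bool, (exists i, i < n /\ c i = true) ->
      ~ FH H (lincomb c As n).

Definition almost_malnormal (K : G -> Prop) : Prop :=
  is_subgroup K /\
  forall g, ~ K g -> finite_set (fun x => K x /\ K (g^-1 * x * g)).

Definition am_closure (H : G -> Prop) : G -> Prop :=
  fun x => forall L, almost_malnormal L -> (forall h, H h -> L h) -> L x.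

End Defs.

Definition hom_on {G X : group} (A : G -> Prop) (f : G -> X) : Prop :=
  forall a b, A a -> A b -> f (gmul a b) = gmul (f a) (f b).

(* G = A *_C B (internal, non-trivial): A, B subgroups with A ∩ B = C,
   A <> C <> B, and G with the inclusions is the pushout (amalgamated free
   product) of A <- C -> B: A ∪ B generates G and every compatible pair of
   homomorphisms A -> X, B -> X extends to a homomorphism G -> X. *)
Definition amalgam_over (G : group) (C : G -> Prop) : Prop :=
  exists A B : G -> Prop,
    is_subgroup G A /\ is_subgroup G B /\
    (forall x, C x <-> (A x /\ B x)) /\
    (exists a, A a /\ ~ C a) /\ (exists b, B b /\ ~ C b) /\
    (forall g, gen G (fun x => A x \/ B x) g) /\
    forall (X : group) (fA fB : G -> X),
      hom_on A fA -> hom_on B fB -> (forall c, C c -> fA c = fB c) ->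
      exists f : G -> X, hom_on (fun _ => True) f /\
        (forall a, A a -> f a = fA a) /\ (forall b, B b -> f b = fB b).

(* G = A *_C (internal HNN extension with stable letter t): C <= A,
   t^-1 C t <= A, A ∪ {t} generates G, and G is the HNN extension
   < A, t | t^-1 c t = phi(c), c in C > with phi(c) = t^-1 c t, i.e. it has
   the corresponding universal property. *)
Definition hnn_over (G : group) (C : G -> Prop) : Prop :=
  exists (A : G -> Prop) (t : G),
    is_subgroup G A /\ (forall c, C c -> A c) /\
    (forall c, C c -> A (gmul (gmul (ginv t) c) t)) /\
    (forall g, gen G (fun x => A x \/ x = t) g) /\
    forall (X : group) (fA : G -> X) (u : X),
      hom_on A fA ->
      (forall c, C c -> fA (gmul (gmul (ginv t) c) t) = gmul (gmul (ginv u) (fA c)) u) ->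
      exists f : G -> X, hom_on (fun _ => True) f /\
        (forall a, A a -> f a = fA a) /\ f t = u.

Definition splits_over (G : group) (C : G -> Prop) : Prop :=
  is_subgroup G C /\ (amalgam_over G C \/ hnn_over G C).

(* Main.v *)
(** Let K be the almost malnormal closure of H, and let A represent a class of
(PG / F_H(G))^G such that neither A nor its complement is H-finite; the boundary
of A lies near H.  For g outside K, almost malnormality makes g H meet this
boundary in a finite set, so g H lies almost entirely on one side of A because H
is one-ended.  The elements k of K such that g k H and g H are on the same side
for all g outside K form an almost malnormal subgroup containing H, hence are
all of K: the whole coset g K lies almost entirely on one side of A.  A side
containing no such coset would be K-finite, and then K would have finite index,
which almost malnormality forbids.

Call two cosets a K, b K different from K equivalent when no translate k A with
k in K separates them, and transport this to the other cosets of K.  If K separates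
a K from b K, then a K does not separate K from b K: otherwise a corner of
two translates of A would have finite boundary while being neither finite nor
cofinite, against the one-endedness of G.  So the translates of an equivalence
class P are nested half-spaces, only finitely many of which separate two given
points, and the stabilizer of P is contained in K.  They are the edges of a tree
with one orbit of edges, and G splits over the stabilizer of P; the universal
property is obtained by evaluating homomorphisms along geodesics. *)

From Stdlib Require Import List Bool Arith Lia Classical ClassicalEpsilon.
Require Import Defs.
Import ListNotations.

Local Notation "x * y" := (gmul x y).
Local Notation "x ^-1" := (ginv x) (at level 2, left associativity).

(** * Identities in groups *)

Section GroupLaws.
Context {G : group}.
Implicit Types x y : G.

Lemma mulKV x y : x^-1 * (x * y) = y.
Proof. now rewrite gmulA, gmulVg, gmul1g. Qed.

Lemma mulVK x y : x * (x^-1 * y) = y.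
Proof. now rewrite gmulA, gmulgV, gmul1g. Qed.

Lemma mul_cancel x y z : x * y = x * z -> y = z.
Proof. intros E. now rewrite <- (mulKV x y), E, mulKV. Qed.

Lemma invK x : x^-1^-1 = x.
Proof. now apply (mul_cancel (x^-1)); rewrite gmulgV, gmulVg. Qed.

Lemma inv_mul x y : (x * y)^-1 = y^-1 * x^-1.
Proof.
apply (mul_cancel (x * y)).
now rewrite gmulgV, <- gmulA, mulVK, gmulgV.
Qed.

Lemma inv_one : gone^-1 = gone :> G.
Proof. now apply (mul_cancel gone); rewrite gmulgV, gmul1g. Qed.

Lemma mul_assoc x y z : (x * y) * z = x * (y * z).
Proof. now rewrite gmulA. Qed.

End GroupLaws.

#[local] Hint Rewrite @mul_assoc @gmul1g @gmulg1 @gmulVg @gmulgV @mulKV @mulVK @invK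
  @inv_mul @inv_one : grp.

Ltac grp := autorewrite with grp in *.
Ltac grpeq := autorewrite with grp; try reflexivity.

Section HomOn.
Context {G X : group} (A : G -> Prop) (f : G -> X).
Hypotheses (Asub : is_subgroup G A) (f_hom : hom_on A f).

Lemma hom_on_one : f gone = gone.
Proof.
destruct Asub as (A1 & _). apply (mul_cancel (f gone)).
rewrite <- f_hom; trivial. grpeq.
Qed.

Lemma hom_on_inv a : A a -> f (a^-1) = (f a)^-1.
Proof.
destruct Asub as (_ & _ & AV). intros Aa. apply (mul_cancel (f a)).
rewrite <- f_hom; auto. grpeq. apply hom_on_one.
Qed.

End HomOn.

Lemma finite_maximum {T : Type} (R : T -> T -> Prop) (Q : T -> Prop) (L : list T) :
  (forall x y z, R x y -> R y z -> R x z) ->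
  (forall x y, Q x -> Q y -> R x y \/ R y x) ->
  (forall x, Q x -> exists l, In l L /\ Q l /\ R x l) ->
  (exists x, Q x) ->
  exists m, Q m /\ forall x, Q x -> R x m.
Proof.
intros Rtrans Rtot cover [x0 Qx0].
assert (H : (forall l, In l L -> ~ Q l) \/
            exists m, Q m /\ forall l, In l L -> Q l -> R l m).
{ clear cover; induction L as [|a L [IH | (m & Qm & IH)]].
  - left; intros l [].
  - destruct (classic (Q a)) as [Qa | Qa].
    + right; exists a; split; [easy |]. intros l [<- | Hl] Ql.
      * now destruct (Rtot a a).
      * now case (IH l Hl).
    + left; intros l [<- | Hl]; auto.
  - right. destruct (classic (Q a)) as [Qa | Qa].
    + destruct (Rtot a m Qa Qm) as [Ram | Rma].
      * exists m; split; [easy |]. intros l [<- | Hl] Ql; auto.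
      * exists a; split; [easy |]. intros l [<- | Hl] Ql; eauto.
        now destruct (Rtot a a).
    + exists m; split; [easy |]. intros l [<- | Hl] Ql; [easy | auto]. }
destruct H as [H | (m & Qm & H)].
- destruct (cover x0 Qx0) as (l & Hl & Ql & _). now case (H l Hl).
- exists m; split; [easy |]. intros x Qx.
  destruct (cover x Qx) as (l & Hl & Ql & Rxl). eauto.
Qed.

(** * Splittings from nested half-spaces *)

Section Splitting.
Variables (G : group) (P : G -> bool).

(* The translate u^-1 P is the half-space x |-> P (u * x). *)
Definition half_stab (c : G) : Prop := forall x, P (c * x) = P x.

(** The base vertex is the set of points that no translate of [P] separates from [gone]; this is its
    stabilizer. *)
Definition base_stab (a : G) : Prop := forall u, P (u * a) = P u.

(* The far endpoint of the edge P lies in u^-1 P iff [far_side u]: only the edge P itself separates it from the base vertex. *)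
Definition far_side (u : G) : Prop := P u = true \/ half_stab u.

Definition far_stab (b : G) : Prop := forall u, far_side (u * b) <-> far_side u.

Definition separates (u y : G) : Prop := P u <> P (u * y).

Hypothesis P1 : P gone = false.
Hypothesis P_nonempty : exists y, P y = true.
(** Together with [nested_in] this gives nestedness and more: no half-space lies strictly between
    [gone] and [P], so the edge [P] is incident with the base vertex. *)
Hypothesis nested_out : forall u, P u = false ->
  (forall x, P (u * x) = true -> P x = true) \/
  (forall x, P (u * x) = true -> P x = false).
Hypothesis nested_in : forall u, P u = true ->
  (forall x, P x = true -> P (u * x) = true) \/
  (forall x, P x = false -> P (u * x) = true).
Hypothesis finite_intervals : forall y, exists L : list G, forall u,
  separates u y -> exists l, In l L /\ forall z, P (u * z) = P (l * z).

Local Ltac atoms :=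
  repeat match goal with
  | H : context [P ?t] |- _ =>
      let b := fresh "b" in set (b := P t) in *; clearbody b; destruct b; try discriminate
  | |- context [P ?t] =>
      let b := fresh "b" in set (b := P t) in *; clearbody b; destruct b
  end.
Local Ltac bsolve := unfold half_stab, separates, far_side in *; grp; atoms; simpl in *;
  try discriminate; intuition discriminate.

Lemma half_stab_subgroup : is_subgroup G half_stab.
Proof.
repeat split.
- now intros x; rewrite gmul1g.
- intros c d Hc Hd x. now rewrite mul_assoc, Hc, Hd.
- intros c Hc x. now rewrite <- (Hc (c^-1 * x)), mulVK.
Qed.

Lemma base_stab_subgroup : is_subgroup G base_stab.
Proof.
repeat split.
- now intros x; rewrite gmulg1.
- intros a b Ha Hb u. now rewrite gmulA, Hb, Ha.
- intros a Ha u. now rewrite <- (Ha (u * a^-1)); grpeq.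
Qed.

Lemma far_stab_subgroup : is_subgroup G far_stab.
Proof.
repeat split; try (now rewrite gmulg1 in *).
- now rewrite gmulA; intros Hu; apply H, H0.
- now rewrite gmulA; intros Hu; apply H0, H.
- intros Hu. apply H in Hu. now grp.
- intros Hu. apply H. now grp.
Qed.

Lemma half_stab_mul c u : half_stab c -> half_stab (u * c) <-> half_stab u.
Proof.
intros Hc; destruct half_stab_subgroup as (_ & HM & HV). split; intros H; auto.
replace u with ((u * c) * c^-1) by grpeq. auto.
Qed.

Lemma half_stab_out c : half_stab c -> P c = false.
Proof. intros Hc. now rewrite <- P1, <- (Hc gone), gmulg1. Qed.

Lemma half_stab_base c : half_stab c -> base_stab c.
Proof.
assert (wlog : forall c u, half_stab c -> P u = false -> P (u * c) = true -> False).
{ clear c; intros c u Hc Pu Puc.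
  pose proof (half_stab_out c Hc).
  destruct (nested_out u Pu) as [N | N].
  - specialize (N c). bsolve.
  - destruct (nested_in _ Puc) as [M | M].
    + destruct P_nonempty as [y Py].
      specialize (M y Py). specialize (N (c * y)). specialize (Hc y). bsolve.
    + destruct half_stab_subgroup as (_ & _ & HV).
      pose proof (half_stab_out _ (HV c Hc)). specialize (M (c^-1)). bsolve. }
intros Hc u. destruct (P u) eqn:Pu, (P (u * c)) eqn:Puc; trivial.
- destruct half_stab_subgroup as (_ & _ & HV).
  case (wlog (c^-1) (u * c)); grpeq; auto.
- case (wlog c u); auto.
Qed.

(** The far sides of two separators share [y] and miss [gone], so they are neither disjoint nor
    covering; nestedness leaves only inclusions. *)
Lemma separators_total y u v : separates u y -> separates v y ->
  (forall z, P (u * z) <> P u -> P (v * z) <> P v) \/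
  (forall z, P (v * z) <> P v -> P (u * z) <> P u).
Proof.
intros Su Sv.
assert (N : (forall z, P (v * z) = true -> P (u * z) = true) \/
  (forall z, P (v * z) = true -> P (u * z) = false) \/
  (forall z, P (u * z) = true -> P (v * z) = true) \/
  (forall z, P (u * z) = false -> P (v * z) = true)).
{ assert (E : forall z, v * z = (v * u^-1) * (u * z)) by (intros; grpeq).
  destruct (P (v * u^-1)) eqn:Pvu.
  - destruct (nested_in _ Pvu) as [N | N]; [right; right; left | right; right; right];
      intros z; rewrite (E z); apply N.
  - destruct (nested_out _ Pvu) as [N | N]; [left | right; left];
      intros z; rewrite (E z); apply N. }
destruct (P u) eqn:Pu, (P v) eqn:Pv; unfold separates in *;
destruct N as [N | [N | [N | N]]]; pose proof (N gone) as N1; pose proof (N y) as Ny;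
  first [ left; intros z; specialize (N z); bsolve; fail
        | right; intros z; specialize (N z); bsolve; fail
        | exfalso; bsolve].
Qed.

(** The largest far side belongs to the first edge of the geodesic from [gone] to [y]. The condition
    [Q] later serves to exclude the edge [P]. *)
Lemma maximal_separator (Q : G -> Prop) y :
  (forall u v, (forall z, P (u * z) = P (v * z)) -> Q u -> Q v) ->
  (exists u, separates u y /\ Q u) ->
  exists u, (separates u y /\ Q u) /\
    forall v, separates v y /\ Q v -> forall z, P (v * z) <> P v -> P (u * z) <> P u.
Proof.
intros Qext ex. destruct (finite_intervals y) as [L HL].
apply (finite_maximum
  (fun v u => forall z, P (v * z) <> P v -> P (u * z) <> P u) _ L); trivial.
- intros a b c Hab Hbc z Hz. auto.
- intros u v [Su _] [Sv _]. now apply (separators_total y).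
- intros u [Su Qu]. destruct (HL u Su) as (l & Hl & E).
  assert (E1 : P u = P l) by (now rewrite <- (gmulg1 _ u), <- (gmulg1 _ l)).
  exists l; split; [easy | split; [split |]].
  + unfold separates in *. now rewrite <- E1, <- E.
  + now apply (Qext u).
  + intros z. now rewrite E, E1.
Qed.

(** An outward first edge starts at the base vertex and also at its translate by [u^-1]. If [g] told
    [gone] from [u], then [g * u] would be a separator with [u^-1] on its far side, against
    maximality. *)
Lemma maximal_separator_out u y :
  separates u y ->
  (forall v, separates v y -> forall z, P (v * z) <> P v -> P (u * z) <> P u) ->
  P u = false -> base_stab u.
Proof.
intros Su maxu Pu g.
destruct (P g) eqn:Pg, (P (g * u)) eqn:Pgu; trivial; exfalso.
- destruct (nested_in _ Pg) as [N | N].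
  + assert (Sv : separates (g * u) y) by (specialize (N (u * y)); bsolve).
    specialize (maxu _ Sv (u^-1)). bsolve.
  + specialize (N u). bsolve.
- destruct (nested_out _ Pg) as [N | N].
  + specialize (N u). bsolve.
  + assert (Sv : separates (g * u) y) by (specialize (N (u * y)); bsolve).
    specialize (maxu _ Sv (u^-1)). bsolve.
Qed.

(** A first edge pointing outwards is a translate of [P] by the base stabilizer. If it points
    inwards, [u] moves the base vertex to the far endpoint of [P]; this is the source of HNN
    extensions. *)
Lemma first_edge y : ~ base_stab y ->
  exists u, separates u y /\
    ((P u = false /\ base_stab u) \/
     (P u = true /\ forall g, separates g u -> half_stab g)).
Proof.
intros Hy.
destruct (maximal_separator (fun _ => True) y) as (u & [Su _] & maxu); trivial.
{ apply NNPP; intros no. apply Hy; intros u.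
  apply NNPP; intros Su. apply no; exists u; split; [unfold separates; congruence | easy]. }
assert (maxu' : forall v, separates v y -> forall z, P (v * z) <> P v -> P (u * z) <> P u)
  by (intros v Sv; exact (maxu v (conj Sv I))).
clear maxu.
pose proof (maximal_separator_out u y Su maxu') as Au.
destruct (P u) eqn:Pu.
2:{ exists u; split; [easy | left; split; [easy |]].
    auto. }
(* An element exchanging the sides of [P] turns the inward edge into an outward one. *)
destruct (classic (exists n, forall x, P (n * x) = negb (P x))) as [[n Hn] | noinv].
- assert (E : forall x, P (n * u * x) = negb (P (u * x)))
    by (now intros x; rewrite <- Hn, mul_assoc).
  assert (E1 : P (n * u) = negb (P u)) by apply Hn.
  exists (n * u); split; [unfold separates in *; rewrite E, E1; bsolve |].
  left; split; [bsolve |].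
  apply (maximal_separator_out _ y).
  + unfold separates in *; rewrite E, E1; bsolve.
  + intros v Sv z Hz. specialize (maxu' v Sv z Hz). rewrite E, E1. bsolve.
  + bsolve.
- exists u; split; [easy | right; split; [easy |]].
  intros g Sg. apply NNPP; intros Cg.
  destruct (P g) eqn:Pg.
  + destruct (nested_in g Pg) as [N | N]; [specialize (N u); bsolve |].
    assert (Sv : separates (g * u) y) by (specialize (N (u * y)); bsolve).
    apply noinv; exists g; intros x.
    specialize (maxu' _ Sv (u^-1 * x)). specialize (N x). bsolve.
  + destruct (nested_out g Pg) as [N | N]; [| specialize (N u); bsolve].
    assert (Sv : separates (g * u) y) by (specialize (N (u * y)); bsolve).
    apply Cg; intros x.
    specialize (maxu' _ Sv (u^-1 * x)). specialize (N x). bsolve.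
Qed.

(** The length of [L] bounds the distance of [y] from the base vertex and is the measure for the
    inductions below. *)
Definition covers (L : list G) (y : G) : Prop := forall u,
  separates u y -> exists l, In l L /\ forall z, P (u * z) = P (l * z).

Lemma covers_shorten k u h L : covers L h -> separates u h ->
  (forall v, separates v (k * h) ->
     separates (v * k) h /\ ~ (forall z, P (v * (k * z)) = P (u * z))) ->
  exists L', length L' < length L /\ covers L' (k * h).
Proof.
intros HL Su Hv. destruct (HL u Su) as (l0 & Hl0 & E0).
destruct (in_split l0 L Hl0) as (L1 & L2 & ->).
exists (map (fun l => l * k^-1) (L1 ++ L2)); split.
- rewrite length_map, !length_app; simpl; lia.
- intros v Sv. destruct (Hv v Sv) as [Svk Nvk].
  destruct (HL _ Svk) as (l & Hl & E).
  exists (l * k^-1); split.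
  + apply (in_map (fun l => l * k^-1)).
    apply in_app_or in Hl; apply in_or_app. destruct Hl as [Hl | [<- | Hl]]; auto.
    case Nvk; intros z. rewrite E0, <- E. grpeq.
  + intros z. rewrite mul_assoc, <- E. grpeq.
Qed.

(** Distinct edges leaving the base vertex bound disjoint half-spaces; here two of them meet, and
    nestedness for [c] and [c^-1] gives both inclusions. *)
Lemma half_stab_edge c x y : base_stab c -> P x = true -> P y = true -> c * x = y ->
  half_stab c.
Proof.
intros Ac Px Py E. destruct base_stab_subgroup as (_ & _ & AV).
assert (Pc : forall a, base_stab a -> P a = false)
  by (now intros a Ha; rewrite <- (gmul1g _ a), Ha).
pose proof (AV c Ac) as Ac'.
assert (E' : c^-1 * y = x) by (rewrite <- E; grpeq).
destruct (nested_out c (Pc c Ac)) as [N | N];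
  [| specialize (N x); rewrite E in N; bsolve].
destruct (nested_out _ (Pc _ Ac')) as [M | M];
  [| specialize (M y); rewrite E' in M; bsolve].
intros z. specialize (N z). specialize (M (c * z)). bsolve.
Qed.

Lemma base_stab_out a : base_stab a -> P a = false.
Proof. intros Aa. now rewrite <- (gmul1g _ a), Aa. Qed.

(** * HNN extensions: one orbit of vertices *)

Section HNN.
Variable t : G.
Hypothesis Pt : P t = true.
Hypothesis adjacent : forall g, separates g t -> half_stab g.

(** By [adjacent], the far endpoint of [P] is the translate of the base vertex by [t]. *)
Lemma hnn_far g : P (g * t) = true <-> far_side g.
Proof.
split; intros H.
- destruct (P g) eqn:Pg; [now left | right; apply adjacent; bsolve].
- destruct H as [H | H]; [| now rewrite H].
  destruct (P (g * t)) eqn:E; trivial.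
  assert (C : half_stab g) by (apply adjacent; bsolve).
  specialize (C t). congruence.
Qed.

Lemma hnn_conj_base c : half_stab c -> base_stab (t^-1 * c * t).
Proof.
intros Cc u. assert (H : far_side (u * t^-1 * c) <-> far_side (u * t^-1)).
{ unfold far_side. now rewrite half_stab_mul, half_stab_base. }
rewrite <- !hnn_far in H. grp. destruct (P u), (P (u * (t^-1 * (c * t)))); intuition congruence.
Qed.

(** Induction on the distance from the base vertex: the base stabilizer brings the first edge of the
    geodesic to [P] or to its translate by [t^-1], and [t] or [t^-1] crosses it. *)
Lemma hnn_induction (Q : G -> Prop) :
  (forall a, base_stab a -> Q a) ->
  (forall a g, base_stab a -> Q g -> P (t * g) = true -> Q (a * (t * g))) ->
  (forall a g, base_stab a -> Q g -> P g = false -> Q (a * (t^-1 * g))) ->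
  forall h, Q h.
Proof.
intros Q0 Q1 Q2.
assert (H : forall n h L, length L < n -> covers L h -> Q h).
2:{ intros h; destruct (finite_intervals h) as [L HL]. apply (H (S (length L)) h L); [lia | easy]. }
destruct base_stab_subgroup as (_ & _ & AV).
induction n as [| n IH]; intros h L Ln HL; [lia |].
destruct (classic (base_stab h)) as [Ah | Ah]; [auto |].
destruct (first_edge h Ah) as (u & Su & [[Pu Au] | [Pu adju]]).
- assert (Puh : P (u * h) = true) by bsolve.
  replace h with (u^-1 * (t * (t^-1 * u * h))) by grpeq.
  apply Q1; auto; [| now grp].
  destruct (covers_shorten (t^-1 * u) u h L HL Su) as (L' & lL' & HL').
  2:{ apply (IH _ L'); trivial; lia. }
  intros v Sv. pose proof (hnn_far (v * t^-1)) as F. pose proof (Au (v * t^-1)) as Auv.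
  assert (NC : ~ half_stab (v * t^-1)).
  { intros C. pose proof (C (u * h)) as Cuh. unfold far_side in F. bsolve. }
  split.
  + unfold far_side in F. bsolve.
  + intros E; apply NC; intros z. specialize (E (u^-1 * z)). now grp.
- assert (Puh : P (u * h) = false) by bsolve.
  (* Both [u] and [t] carry the base vertex to the far endpoint of [P]. *)
  assert (Au : base_stab (u^-1 * t)).
  { intros v. pose proof (hnn_far (v * u^-1)) as F. rewrite gmulA.
    specialize (adju (v * u^-1)).
    destruct (P v) eqn:Pv.
    - apply F. destruct (P (v * u^-1)) eqn:E; [now left |].
      right; apply adju. bsolve.
    - destruct (P (v * u^-1 * t)) eqn:E; trivial.
      assert (C : half_stab (v * u^-1)).
      { destruct F as [F _]. destruct (F eq_refl) as [F1 | F1]; trivial. apply adju. bsolve. }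
      specialize (C u). bsolve. }
  replace h with ((u^-1 * t) * (t^-1 * (u * h))) by grpeq.
  apply Q2; auto.
  destruct (covers_shorten u u h L HL Su) as (L' & lL' & HL').
  2:{ apply (IH _ L'); trivial; lia. }
  intros v Sv.
  assert (NC : ~ half_stab v).
  { intros C. pose proof (C (u * h)). pose proof (half_stab_out v C). bsolve. }
  specialize (adju v). split; [| intros E; apply NC; intros z; specialize (E (u^-1 * z)); now grp].
  bsolve.
Qed.

(** An outward edge at the base vertex cannot also be an inward one: [t * c] would exchange the
    sides of [P], which [hnn_far] excludes. *)
Lemma hnn_turn c g g' : base_stab c -> P (t * g) = true -> P g' = false ->
  c * (t * g) = t^-1 * g' -> False.
Proof.
intros Ac Ptg Pg' E. destruct base_stab_subgroup as (_ & _ & AV).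
assert (E' : t * c * (t * g) = g') by (rewrite <- gmulA, E; grpeq).
assert (Ptc : P (t * c) = true) by (now rewrite Ac).
destruct (nested_in _ Ptc) as [N | N].
- specialize (N _ Ptg). congruence.
- specialize (N (c^-1 * t^-1)). pose proof (base_stab_out _ (AV c Ac)).
  destruct (hnn_far (c^-1 * t^-1)) as [_ F]. unfold far_side in F. bsolve.
Qed.

Lemma hnn_edge_in d g g' : base_stab d -> P g = false -> P g' = false ->
  d * (t^-1 * g) = t^-1 * g' -> half_stab (t * d * t^-1).
Proof.
intros Ad Pg Pg' E.
assert (E' : t * d * t^-1 * g = g') by (rewrite !mul_assoc, E; grpeq).
assert (E'' : t * d^-1 * t^-1 * g' = g) by (rewrite <- E'; grpeq).
assert (crit : forall d g g', base_stab d -> P g = false -> P g' = false ->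
  t * d * t^-1 * g = g' ->
  half_stab (t * d * t^-1) \/ forall x, P x = true -> P (t * d * t^-1 * x) = true).
{ clear d g g' Ad Pg Pg' E E' E''; intros d g g' Ad Pg Pg' E.
  destruct (P (t * d * t^-1)) eqn:Pc.
  - right. destruct (nested_in _ Pc) as [N | N]; trivial. specialize (N g Pg). congruence.
  - left. apply adjacent. unfold separates. rewrite Pc. grp. rewrite Ad. congruence. }
destruct half_stab_subgroup as (_ & _ & CV).
destruct base_stab_subgroup as (_ & _ & AV).
destruct (crit d g g') as [C | N]; trivial.
destruct (crit (d^-1) g' g) as [C | M]; auto.
- replace (t * d * t^-1) with ((t * d^-1 * t^-1)^-1) by grpeq. auto.
- intros x. specialize (N x). specialize (M (t * d * t^-1 * x)). bsolve.
Qed.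

Section Extension.
Variables (X : group) (fA : G -> X) (s : X).
Hypothesis fA_hom : hom_on base_stab fA.
Hypothesis fA_conj : forall c, half_stab c ->
  fA (t^-1 * c * t) = s^-1 * fA c * s.

(* Evaluates [fA] and [s] along the geodesic from the base vertex to its translate. *)
Inductive hnn_eval : G -> X -> Prop :=
| hnn_eval0 a : base_stab a -> hnn_eval a (fA a)
| hnn_eval_out a g x : base_stab a -> hnn_eval g x -> P (t * g) = true ->
    hnn_eval (a * (t * g)) (fA a * (s * x))
| hnn_eval_in a g x : base_stab a -> hnn_eval g x -> P g = false ->
    hnn_eval (a * (t^-1 * g)) (fA a * (s^-1 * x)).

Lemma hnn_eval_base a g x :
  base_stab a -> hnn_eval g x -> hnn_eval (a * g) (fA a * x).
Proof.
destruct base_stab_subgroup as (_ & AM & _).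
intros Aa [b Ab | b h y Ab Hy Pth | b h y Ab Hy Ph].
- rewrite <- fA_hom; auto. now constructor; auto.
- rewrite !gmulA, <- fA_hom, <- !gmulA, (gmulA _ a b); auto. constructor; auto.
- rewrite !gmulA, <- fA_hom, <- !gmulA, (gmulA _ a b); auto. constructor; auto.
Qed.

(** Two decompositions cross the same first edge, so their first factors differ by an element of the
    edge group or of its conjugate by [t]. The relation [fA_conj] moves this element past [s] into
    the remainder. *)
Lemma hnn_eval_unique h x : hnn_eval h x -> forall h' x', hnn_eval h' x' -> h = h' -> x = x'.
Proof.
destruct base_stab_subgroup as (_ & AM & AV).
assert (shift : forall a a' g g' : G, a * g = a' * g' -> (a'^-1 * a) * g = g')
  by (intros a a' g g' E; rewrite <- gmulA, E; grpeq).
induction 1 as [a Aa | a g x Aa Hx IH Ptg | a g x Aa Hx IH Pg];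
intros h' x' [a' Aa' | a' g' y Aa' Hy Ptg' | a' g' y Aa' Hy Pg'] E.
- now rewrite E.
- exfalso. assert (P (t * g') = false); [| congruence].
  rewrite <- (mulKV a' (t * g')), <- E. apply base_stab_out; auto.
- exfalso. assert (P g' = true); [| congruence].
  replace g' with (t * (a'^-1 * a)) by (rewrite E; grpeq).
  rewrite AM; auto.
- exfalso. assert (P (t * g) = false); [| congruence].
  rewrite <- (mulKV a (t * g)), E. apply base_stab_out; auto.
- assert (E' := shift _ _ _ _ E).
  assert (Ac : base_stab (a'^-1 * a)) by auto.
  assert (Cc : half_stab (a'^-1 * a)) by (apply (half_stab_edge _ _ _ Ac Ptg Ptg' E')).
  set (c := a'^-1 * a) in *.
  assert (Ea : a = a' * c) by (unfold c; grpeq).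
  assert (Eg : g = (t^-1 * c * t)^-1 * g')
    by (apply (mul_cancel t), (mul_cancel c); rewrite E'; grpeq).
  assert (Ad := hnn_conj_base c Cc).
  assert (Ex := IH _ _ (hnn_eval_base _ _ _ (AV _ Ad) Hy) Eg).
  rewrite (hom_on_inv _ _ base_stab_subgroup fA_hom), fA_conj in Ex by trivial.
  rewrite Ex, Ea, fA_hom by trivial. grpeq.
- exfalso. apply (hnn_turn (a'^-1 * a) g g'); auto.
- exfalso. assert (P g = true); [| congruence].
  replace g with (t * (a^-1 * a')) by (rewrite <- E; grpeq).
  rewrite AM; auto.
- exfalso. apply (hnn_turn (a^-1 * a') g' g); auto.
- assert (E' := shift _ _ _ _ E).
  assert (Ac : base_stab (a'^-1 * a)) by auto.
  assert (Cc := hnn_edge_in _ _ _ Ac Pg Pg' E').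
  set (d := a'^-1 * a) in *. set (c := t * d * t^-1) in *.
  assert (Ea : a = a' * (t^-1 * c * t)) by (unfold c, d; grpeq).
  assert (Eg : g = c^-1 * g')
    by (apply (mul_cancel (t^-1)), (mul_cancel d); rewrite E'; unfold c; grpeq).
  assert (Ex := IH _ _ (hnn_eval_base _ _ _ (AV _ (half_stab_base c Cc)) Hy) Eg).
  rewrite (hom_on_inv _ _ base_stab_subgroup fA_hom) in Ex by (now apply half_stab_base).
  rewrite Ex, Ea, fA_hom, fA_conj by (trivial; now apply hnn_conj_base). grpeq.
Qed.

Lemma hnn_extension : exists f : G -> X, hom_on (fun _ => True) f /\
  (forall a, base_stab a -> f a = fA a) /\ f t = s.
Proof.
destruct base_stab_subgroup as (A1 & _).
assert (ex : forall h, exists x, hnn_eval h x).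
{ apply hnn_induction.
  - intros a Aa; eexists; now apply hnn_eval0.
  - intros a g Aa [x Hx] Ptg; eexists; now apply hnn_eval_out; eauto.
  - intros a g Aa [x Hx] Pg; eexists; now apply hnn_eval_in; eauto. }
destruct (choice _ ex) as [f Hf].
assert (fE : forall h x, hnn_eval h x -> f h = x)
  by (intros h x Hx; now apply (hnn_eval_unique h _ (Hf h) h)).
assert (fAE : forall a, base_stab a -> f a = fA a) by (intros a Aa; apply fE; now constructor).
assert (fa : forall a g, base_stab a -> f (a * g) = fA a * f g)
  by (intros a g Aa; apply fE; now apply hnn_eval_base).
assert (ft : forall g, f (t * g) = s * f g).
{ intros g. destruct (P (t * g)) eqn:Ptg.
  - apply fE. pose proof (hnn_eval_out gone g (f g) A1 (Hf g) Ptg) as H.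
    rewrite (hom_on_one _ _ base_stab_subgroup fA_hom) in H. now grp.
  (* Here [g] is [t^-1] times a point outside [P], so its own evaluation can start with [s^-1]. *)
  - pose proof (hnn_eval_in gone (t * g) _ A1 (Hf _) Ptg) as H.
    rewrite (hom_on_one _ _ base_stab_subgroup fA_hom) in H. grp. apply fE in H. rewrite H. grpeq. }
exists f; split; [| split; [easy |]].
- intros g h _ _. revert g. apply hnn_induction.
  + intros a Aa. now rewrite fa, (fAE a).
  + intros a g Aa IH _. rewrite !mul_assoc, !(fa a), !ft, IH by trivial. grpeq.
  + intros a g Aa IH _.
    assert (ft' : forall g, f (t^-1 * g) = s^-1 * f g)
      by (intros k; apply (mul_cancel s); rewrite <- ft; grpeq).
    rewrite !mul_assoc, !(fa a), !ft', IH by trivial. grpeq.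
- rewrite <- (gmulg1 _ t), ft, fAE, (hom_on_one _ _ base_stab_subgroup fA_hom) by trivial. grpeq.
Qed.

End Extension.

Lemma hnn_splitting : hnn_over G half_stab.
Proof.
exists base_stab, t. repeat split.
- apply base_stab_subgroup.
- apply base_stab_subgroup.
- apply base_stab_subgroup.
- apply half_stab_base.
- apply hnn_conj_base.
- apply hnn_induction.
  + intros a Aa. rewrite <- (gmulg1 _ a). apply genM; [now left | constructor].
  + intros a g Aa Hg _. apply genM; [now left |]. apply genM; [now right | easy].
  + intros a g Aa Hg _. apply genM; [now left |]. apply genV; [now right | easy].
- intros X fA s HA HC. now apply hnn_extension.
Qed.

End HNN.

(** * Amalgams: two orbits of vertices *)

Section Amalgam.
Hypothesis not_adjacent : forall t, P t = true ->
  exists g, separates g t /\ ~ half_stab g.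

Lemma base_edge h : ~ base_stab h -> exists a, base_stab a /\ P (a * h) = true.
Proof.
intros Ah. destruct (first_edge h Ah) as (u & Su & [[Pu Au] | [Pu adj]]).
- exists u; split; [easy | bsolve].
- destruct (not_adjacent u Pu) as (g & Sg & Cg). now case Cg; apply adj.
Qed.

(** The translate by [u^-1] is the next edge after [P] towards [y] and points back, so it ends at
    the far endpoint of [P], which [u] therefore fixes. *)
Lemma maximal_separator_far u y : P y = true -> ~ half_stab u -> separates u y ->
  (forall v, separates v y -> ~ half_stab v ->
     forall z, P (v * z) <> P v -> P (u * z) <> P u) ->
  P u = true -> far_stab u.
Proof.
intros Py Cu Su maxu Pu.
assert (U : forall x, P x = false -> P (u * x) = true).
{ destruct (nested_in u Pu) as [N | N]; trivial. specialize (N y). bsolve. }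
assert (Puy : P (u * y) = false) by bsolve.
intros g; split.
- intros Wgu. apply NNPP; intros Wg.
  destruct (P g) eqn:Pg; [apply Wg; now left |].
  assert (Cg : ~ half_stab g) by (intros C; apply Wg; now right).
  destruct (P (g * u)) eqn:Pgu.
  + destruct (nested_out g Pg) as [N | N]; [| specialize (N u); bsolve].
    assert (Sv : separates (g * u) y) by (specialize (N (u * y)); bsolve).
    assert (Cv : ~ half_stab (g * u)) by (intros C; apply half_stab_out in C; congruence).
    apply Cg; intros x. specialize (maxu _ Sv Cv (u^-1 * x)). specialize (N x). bsolve.
  + destruct Wgu as [W | C]; [congruence |].
    specialize (C (u^-1)). specialize (U (u^-1)). bsolve.
- intros Wg. apply NNPP; intros Wgu.
  destruct (P (g * u)) eqn:Pgu; [apply Wgu; now left |].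
  assert (Cgu : ~ half_stab (g * u)) by (intros C; apply Wgu; now right).
  destruct Wg as [Pg | C]; [| specialize (C u); congruence].
  destruct (nested_in g Pg) as [N | N]; [specialize (N u); bsolve |].
  assert (Sv : separates (g * u) y) by (specialize (N (u * y)); bsolve).
  assert (Hv := maxu _ Sv Cgu).
  assert (inv : forall x, P (g * x) = negb (P x))
    by (intros x; specialize (Hv (u^-1 * x)); specialize (N x); bsolve).
  assert (Cg : ~ half_stab g) by (intros C; apply half_stab_out in C; congruence).
  assert (Sg : separates g y) by (unfold separates; rewrite inv, Pg, Py; discriminate).
  apply Cgu; intros z. specialize (maxu g Sg Cg z). rewrite mul_assoc, inv.
  rewrite inv in maxu. specialize (U z). bsolve.
Qed.

(** If the next edge after [P] points back, it supplies [b]. If it points forward and no element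
    exchanges the sides of [P], it starts at a translate of the base vertex; this would be the far
    endpoint of [P], against [not_adjacent]. *)
Lemma far_edge y : P y = true -> exists b, far_stab b /\ P (b * y) = false.
Proof.
intros Py.
destruct (maximal_separator (fun u => ~ half_stab u) y) as (u & [Su Cu] & maxu).
{ intros u v E Cu Cv; apply Cu; intros x; now rewrite E. }
{ now apply not_adjacent. }
assert (maxu' : forall v, separates v y -> ~ half_stab v ->
     forall z, P (v * z) <> P v -> P (u * z) <> P u)
  by (intros v Sv Cv; exact (maxu v (conj Sv Cv))).
clear maxu. assert (Bu := maximal_separator_far u y Py Cu Su maxu').
destruct (P u) eqn:Pu; [exists u; split; [auto | bsolve] |].
(* The half-space of [n * u] is the complement of that of [u], hence again a maximal separator, now
   pointing back. *)
destruct (classic (exists n, forall x, P (n * x) = negb (P x))) as [[n Hn] | noinv].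
- assert (E : forall x, P (n * u * x) = negb (P (u * x)))
    by (now intros x; rewrite <- Hn, mul_assoc).
  assert (E1 : P (n * u) = negb (P u)) by apply Hn.
  exists (n * u); split; [| rewrite E; bsolve].
  apply (maximal_separator_far _ y Py).
  + intros C. apply half_stab_out in C. rewrite E1, Pu in C. discriminate.
  + unfold separates in *; rewrite E, E1; bsolve.
  + intros v Sv Cv z Hz. specialize (maxu' v Sv Cv z Hz). rewrite E, E1. bsolve.
  + rewrite E1, Pu. easy.
- exfalso.
  assert (Nu : forall x, P (u * x) = true -> P x = true).
  { destruct (nested_out u Pu) as [N | N]; trivial. specialize (N y). bsolve. }
  assert (Pu' : P (u^-1) = true).
  { destruct (P (u^-1)) eqn:Pu'; trivial. case Cu; intros x.
    destruct (nested_out _ Pu') as [N | N].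
    - specialize (N (u * x)). specialize (Nu x). bsolve.
    - specialize (N (u * y)). bsolve. }
  destruct (not_adjacent _ Pu') as (g & Sg & Cg).
  assert (Ev : forall z, g * z = (g * u^-1) * (u * z)) by (intros z; grpeq).
  destruct (P g) eqn:Pg.
  + assert (Pv : P (g * u^-1) = false) by bsolve.
    destruct (nested_in g Pg) as [N | N]; [specialize (N (u^-1)); bsolve |].
    destruct (nested_out _ Pv) as [M | M];
      [specialize (M u); bsolve |].
    assert (M' : forall z, P (g * z) = true -> P (u * z) = false)
      by (intros z; rewrite (Ev z); apply M).
    assert (Sgy : separates g y) by (specialize (M' y); bsolve).
    apply noinv; exists (g * u^-1); intros x.
    specialize (maxu' g Sgy Cg (u^-1 * x)). specialize (M x). bsolve.
  + assert (Pv : P (g * u^-1) = true) by bsolve.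
    destruct (nested_in _ Pv) as [M | M]; [| specialize (M u); bsolve].
    assert (M' : forall z, P (u * z) = true -> P (g * z) = true)
      by (intros z; rewrite (Ev z); apply M).
    assert (Sgy : separates g y) by (specialize (M' y); bsolve).
    specialize (maxu' g Sgy Cg (u^-1)). bsolve.
Qed.

Lemma half_stab_far c : half_stab c -> far_stab c.
Proof.
intros Cc u. unfold far_side. rewrite half_stab_mul by trivial.
now rewrite half_stab_base.
Qed.

Lemma base_far_stab c : half_stab c <-> base_stab c /\ far_stab c.
Proof.
split; [intros C; split; [now apply half_stab_base | now apply half_stab_far] |].
intros [Ac Bc]. destruct (Bc gone) as [_ B].
destruct half_stab_subgroup as (C1 & _).
rewrite gmul1g in B. destruct B as [W | C]; trivial; [now right |].
now rewrite base_stab_out in W.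
Qed.

(** One step of the geodesic turns about the base vertex until [h] lies in [P], then about the far
    vertex until it leaves [P]; the first edge is thereby lost. *)
Lemma amalgam_induction (Q : G -> Prop) :
  (forall a, base_stab a -> Q a) ->
  (forall a b g, base_stab a -> far_stab b -> Q g ->
     P g = false -> P (b * g) = true -> Q (a * (b * g))) ->
  forall h, Q h.
Proof.
intros Q0 Q1.
assert (H : forall n h L, length L < n -> covers L h -> Q h).
2:{ intros h; destruct (finite_intervals h) as [L HL].
    apply (H (S (length L)) h L); [lia | easy]. }
destruct base_stab_subgroup as (_ & _ & AV).
destruct far_stab_subgroup as (_ & _ & BV).
induction n as [| n IH]; intros h L Ln HL; [lia |].
destruct (classic (base_stab h)) as [Ah | Ah]; [auto |].
destruct (base_edge h Ah) as (a & Aa & Pah).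
destruct (far_edge _ Pah) as (b & Bb & Pbah).
assert (Pa := base_stab_out a Aa).
assert (Sa : separates a h) by (unfold separates; congruence).
replace h with (a^-1 * (b^-1 * (b * a * h))) by grpeq.
apply Q1; auto; [| now rewrite mul_assoc | now grp].
destruct (covers_shorten (b * a) a h L HL Sa) as (L' & lL' & HL').
2:{ apply (IH _ L'); trivial; lia. }
intros v Sv.
assert (Cv : ~ half_stab v).
{ intros C. pose proof (C (b * (a * h))). pose proof (half_stab_out v C). bsolve. }
assert (Cvb : ~ half_stab (v * b)).
{ intros C. pose proof (C (a * h)). pose proof (Bb v) as F.
  assert (W : far_side (v * b)) by now right.
  apply F in W. destruct W as [W | W]; [bsolve | easy]. }
split.
- pose proof (Bb v) as F. pose proof (Aa (v * b)). unfold far_side in F.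
  grp. unfold separates in *. grp. destruct (P v), (P (v * b)); bsolve.
- intros E; apply Cvb; intros z. specialize (E (a^-1 * z)). now grp.
Qed.

(** The analogue of [half_stab_edge] at the far vertex: edges pointing to it have disjoint
    complements unless they coincide. *)
Lemma far_stab_edge d g g' : far_stab d -> P g = false -> P g' = false -> d * g = g' ->
  half_stab d.
Proof.
assert (crit : forall d g g', far_stab d -> P g = false -> P g' = false -> d * g = g' ->
  half_stab d \/ forall x, P x = true -> P (d * x) = true).
{ intros e k k' Be Pk Pk' E. destruct (P e) eqn:Pe.
  - right. destruct (nested_in e Pe) as [N | N]; trivial.
    specialize (N k Pk). congruence.
  - left. destruct (Be gone) as [_ B]. rewrite gmul1g in B.
    destruct B as [B | B]; trivial; [right; apply half_stab_subgroup | congruence]. }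
intros Bd Pg Pg' E. destruct half_stab_subgroup as (_ & _ & CV).
destruct far_stab_subgroup as (_ & _ & BV).
destruct (crit d g g') as [C | N]; trivial.
destruct (crit (d^-1) g' g) as [C | M]; auto.
- rewrite <- E; grpeq.
- rewrite <- (invK d). auto.
- intros x. specialize (N x). specialize (M (d * x)). bsolve.
Qed.

Section Extension.
Variables (X : group) (fA fB : G -> X).
Hypothesis fA_hom : hom_on base_stab fA.
Hypothesis fB_hom : hom_on far_stab fB.
Hypothesis fAB : forall c, half_stab c -> fA c = fB c.

Inductive amalgam_eval : G -> X -> Prop :=
| amalgam_eval0 a : base_stab a -> amalgam_eval a (fA a)
| amalgam_eval1 a b g x : base_stab a -> far_stab b -> amalgam_eval g x ->
    P g = false -> P (b * g) = true -> amalgam_eval (a * (b * g)) (fA a * (fB b * x)).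

Lemma amalgam_eval_base a g x :
  base_stab a -> amalgam_eval g x -> amalgam_eval (a * g) (fA a * x).
Proof.
destruct base_stab_subgroup as (_ & AM & _).
intros Aa [a' Aa' | a' b h y Aa' Bb Hy Ph Pbh].
- rewrite <- fA_hom; auto. now constructor; auto.
- rewrite !(gmulA _ a), (gmulA _ (fA a)), <- fA_hom; auto. constructor; auto.
Qed.

(** The first factors differ by some [c] in the edge group, and then the second ones by some [d] in
    it. As [fA] and [fB] agree there, both can be passed on to the remainder. *)
Lemma amalgam_eval_unique h x : amalgam_eval h x ->
  forall h' x', amalgam_eval h' x' -> h = h' -> x = x'.
Proof.
destruct base_stab_subgroup as (_ & AM & AV).
destruct far_stab_subgroup as (_ & BM & BV).
induction 1 as [a Aa | a b g x Aa Bb Hx IH Pg Pbg];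
intros h' x' [a' Aa' | a' b' g' y Aa' Bb' Hy Pg' Pbg'] E.
- now rewrite E.
- exfalso. assert (P (b' * g') = false); [| congruence].
  rewrite <- (mulKV a' (b' * g')), <- E. apply base_stab_out; auto.
- exfalso. assert (P (b * g) = false); [| congruence].
  rewrite <- (mulKV a (b * g)), E. apply base_stab_out; auto.
- assert (E1 : (a'^-1 * a) * (b * g) = b' * g') by (rewrite <- gmulA, E; grpeq).
  assert (Ac : base_stab (a'^-1 * a)) by auto.
  assert (Cc : half_stab (a'^-1 * a)) by (apply (half_stab_edge _ _ _ Ac Pbg Pbg' E1)).
  set (c := a'^-1 * a) in *.
  assert (Ea : a = a' * c) by (unfold c; grpeq).
  assert (E2 : (b'^-1 * (c * b)) * g = g') by (rewrite !mul_assoc, E1; grpeq).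
  assert (Bc := half_stab_far c Cc).
  assert (Bd : far_stab (b'^-1 * (c * b))) by auto.
  assert (Cd := far_stab_edge _ _ _ Bd Pg Pg' E2).
  assert (Eb : c * b = b' * (b'^-1 * (c * b))) by grpeq.
  set (d := b'^-1 * (c * b)) in *.
  assert (Ad := half_stab_base d Cd).
  assert (Eg : g = d^-1 * g') by (rewrite <- E2; grpeq).
  assert (Ex := IH _ _ (amalgam_eval_base _ _ _ (AV _ Ad) Hy) Eg).
  rewrite (hom_on_inv _ _ base_stab_subgroup fA_hom d Ad), fAB in Ex by trivial.
  assert (Ef : fB c * fB b = fB b' * fB d) by (rewrite <- !fB_hom by trivial; now f_equal).
  rewrite Ex, Ea, fA_hom, (fAB c Cc), mul_assoc, (gmulA _ (fB c)), Ef by trivial.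
  grpeq.
Qed.

Lemma amalgam_extension : exists f : G -> X, hom_on (fun _ => True) f /\
  (forall a, base_stab a -> f a = fA a) /\ (forall b, far_stab b -> f b = fB b).
Proof.
destruct base_stab_subgroup as (A1 & _).
destruct far_stab_subgroup as (B1 & BM & BV).
assert (ex : forall h, exists x, amalgam_eval h x).
{ apply amalgam_induction.
  - intros a Aa; eexists; now apply amalgam_eval0.
  - intros a b g Aa Bb [x Hx] Pg Pbg; eexists; now apply amalgam_eval1; eauto. }
destruct (choice _ ex) as [f Hf].
assert (fE : forall h x, amalgam_eval h x -> f h = x)
  by (intros h x Hx; now apply (amalgam_eval_unique h _ (Hf h) h)).
assert (fAE : forall a, base_stab a -> f a = fA a) by (intros a Aa; apply fE; now constructor).
assert (fa : forall a g, base_stab a -> f (a * g) = fA a * f g)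
  by (intros a g Aa; apply fE; now apply amalgam_eval_base).
assert (fb_out : forall b g, far_stab b -> P g = false -> f (b * g) = fB b * f g).
{ intros b g Bb Pg. destruct (P (b * g)) eqn:Pbg.
  - apply fE. pose proof (amalgam_eval1 gone b g _ A1 Bb (Hf g) Pg Pbg) as H.
    rewrite (hom_on_one _ _ base_stab_subgroup fA_hom) in H. now grp.
  - assert (Cb := far_stab_edge b g _ Bb Pg Pbg eq_refl).
    rewrite <- fAB by trivial. apply fa. now apply half_stab_base. }
assert (fb : forall b g, far_stab b -> f (b * g) = fB b * f g).
(* For [g] in [P], move it out by some [b1] of the far stabilizer and apply the previous case to
   [b' * b1^-1]. *)
{ intros b g Bb. destruct (P g) eqn:Pg; [| auto].
  destruct (far_edge g Pg) as (b1 & Bb1 & Pb1g).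
  assert (E : forall b', far_stab b' -> f (b' * g) = fB b' * (fB b1)^-1 * f (b1 * g)).
  { intros b' Bb'. rewrite <- (hom_on_inv _ _ far_stab_subgroup fB_hom), <- fB_hom, <- fb_out by auto. f_equal; grpeq. }
  rewrite (E b Bb). rewrite <- (gmul1g _ g) at 2. rewrite (E gone B1).
  rewrite (hom_on_one _ _ far_stab_subgroup fB_hom). grpeq. }
exists f; split; [| split; [easy |]].
- intros g h _ _. revert g. apply amalgam_induction.
  + intros a Aa. now rewrite fa, (fAE a).
  + intros a b g Aa Bb IH _ _. rewrite !mul_assoc, !(fa a), !(fb b), IH by trivial. grpeq.
- intros b Bb. rewrite <- (gmulg1 _ b) at 1. rewrite fb, fAE, (hom_on_one _ _ base_stab_subgroup fA_hom) by trivial. grpeq.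
Qed.

End Extension.

(** The point [y] yields a second edge at the base vertex, so that the first factor is larger than
    the edge group. *)
Lemma amalgam_splitting : (exists y, P y = false /\ ~ half_stab y) -> amalgam_over G half_stab.
Proof.
intros (y & Py & Cy). exists base_stab, far_stab.
split; [apply base_stab_subgroup |]. split; [apply far_stab_subgroup |].
split; [apply base_far_stab |]. split; [| split; [| split]].
- destruct (classic (base_stab y)) as [Ay | Ay]; [now exists y |].
  destruct (base_edge y Ay) as (a & Aa & Pay). exists a; split; trivial.
  intros C. specialize (C y). congruence.
- destruct P_nonempty as [z Pz]. destruct (far_edge z Pz) as (b & Bb & Pbz).
  exists b; split; trivial. intros C. specialize (C z). congruence.
- apply amalgam_induction.
  + intros a Aa. rewrite <- (gmulg1 _ a). apply genM; [now left | constructor].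
  + intros a b g Aa Bb Hg _ _. apply genM; [now left |]. apply genM; [now right | easy].
- intros X fA fB HA HB HAB. now apply amalgam_extension.
Qed.

End Amalgam.

Theorem nested_half_space_splitting : (exists y, P y = false /\ ~ half_stab y) ->
  splits_over G half_stab.
Proof.
intros Hy. split; [apply half_stab_subgroup |].
destruct (classic (exists t, P t = true /\ forall g, separates g t -> half_stab g))
  as [(t & Pt & adj) | no].
- right. now apply (hnn_splitting t).
- left. apply amalgam_splitting; trivial.
  intros t Pt. apply NNPP; intros H. apply no; exists t; split; trivial.
  intros g Sg. apply NNPP; intros Cg. apply H; now exists g.
Qed.

End Splitting.

Lemma finite_representatives {T U : Type} (lab : T -> U -> Prop) (E : T -> T -> Prop)
    (M : list U) : (forall m u u', lab u m -> lab u' m -> E u u') ->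
  exists L, forall u m, In m M -> lab u m -> exists l, In l L /\ E u l.
Proof.
intros HE. induction M as [| m M [L HL]].
- exists []. intros u m [].
- destruct (classic (exists l, lab l m)) as [[l Hl] | no].
  + exists (l :: L). intros u m' [<- | Hm'] Hu.
    * exists l; split; [now left | eauto].
    * destruct (HL u m' Hm' Hu) as (l' & Hl' & Ul'). exists l'; split; [now right | easy].
  + exists L. intros u m' [<- | Hm'] Hu; [case no; now exists u | eauto].
Qed.

(** * Finite sets and finite thickenings of subsets *)

Section FiniteSets.
Context {G : group}.
Implicit Types P Q : G -> Prop.

Lemma finite_sub P Q : (forall x, P x -> Q x) -> finite_set G Q -> finite_set G P.
Proof. intros PQ [L HL]; exists L; auto. Qed.

Lemma finite_mul_l g P Q :
  finite_set G Q -> (forall x, P x -> Q (g * x)) -> finite_set G P.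
Proof.
intros [L HL] PQ; exists (map (fun y => g^-1 * y) L); intros x Px.
rewrite <- (mulKV g x). now apply (in_map (fun y => g^-1 * y)), HL, PQ.
Qed.

Lemma finite_mul_r g P Q :
  finite_set G Q -> (forall x, P x -> Q (x * g)) -> finite_set G P.
Proof.
intros [L HL] PQ; exists (map (fun y => y * g^-1) L); intros x Px.
replace x with (x * g * g^-1) by grpeq.
now apply (in_map (fun y => y * g^-1)), HL, PQ.
Qed.

Lemma finite_list_union {T : Type} (L : list T) (Q : T -> G -> Prop) :
  (forall l, In l L -> finite_set G (Q l)) ->
  finite_set G (fun x => exists l, In l L /\ Q l x).
Proof.
induction L as [| a L IH]; intros HL.
- exists []. now intros x (l & [] & _).
- destruct IH as [M HM]; [auto using in_cons |].
  destruct (HL a) as [N HN]; [now left |].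
  exists (N ++ M). intros x (l & [<- | Hl] & Qx); apply in_or_app; [auto | right].
  apply HM; now exists l.
Qed.

Lemma finite_union P Q : finite_set G P -> finite_set G Q ->
  finite_set G (fun x => P x \/ Q x).
Proof.
intros [L HL] [M HM]; exists (L ++ M); intros x [Hx | Hx]; apply in_or_app; auto.
Qed.

(** Membership in the product set P F. *)
Definition near P (F : list G) (x : G) : Prop := exists f, In f F /\ P (x * f^-1).

Lemma near_app_l P F F' x : near P F x -> near P (F ++ F') x.
Proof. intros (f & Hf & Hx). exists f; split; auto using in_or_app. Qed.

Lemma near_app_r P F F' x : near P F' x -> near P (F ++ F') x.
Proof. intros (f & Hf & Hx). exists f; split; auto using in_or_app. Qed.

Lemma near_sub P Q F x : (forall y, P y -> Q y) -> near P F x -> near Q F x.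
Proof. intros PQ (f & Hf & Hx). exists f; auto. Qed.

Lemma near_mul P F x g : near P F (x * g) -> near P (map (fun f => f * g^-1) F) x.
Proof.
intros (f & Hf & Hx). exists (f * g^-1); split.
- now apply (in_map (fun f => f * g^-1)).
- now grp.
Qed.

Lemma near_list_union {T : Type} P (F : T -> list G) (L : list T) :
  exists F', forall l x, In l L -> near P (F l) x -> near P F' x.
Proof.
exists (flat_map F L). intros l x Hl (f & Hf & Hx).
exists f; split; trivial. apply in_flat_map. now exists l.
Qed.

End FiniteSets.

(** * One-endedness *)

Section Ends.
Variables (G : group) (P : G -> Prop).
Hypothesis Psub : is_subgroup G P.

Lemma reach_trans S K (x y z : G) : reach G S K x y -> reach G S K y z -> reach G S K x z.
Proof.
intros Hxy; induction 1 as [| z s _ IH Hs Hz | z s _ IH Hs Hz]; trivial.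
- now apply reachR.
- now apply reachL.
Qed.

Lemma reach_avoids S K (x y : G) : ~ In x K -> reach G S K x y -> ~ In y K.
Proof. intros Hx; induction 1; auto. Qed.

Lemma reach_sym S K (x y : G) : ~ In x K -> reach G S K x y -> reach G S K y x.
Proof.
intros Hx; induction 1 as [| y s Hy IH Hs Hys | y s Hy IH Hs Hys].
- apply reach0.
- apply reach_trans with y; trivial.
  replace (reach G S K (y * s) y) with (reach G S K (y * s) ((y * s) * s^-1))
    by (f_equal; grpeq).
  apply reachL; trivial; [apply reach0 |].
  replace (y * s * s^-1) with y by grpeq. now apply (reach_avoids S K x).
- apply reach_trans with y; trivial.
  replace (reach G S K (y * s^-1) y) with (reach G S K (y * s^-1) ((y * s^-1) * s))
    by (f_equal; grpeq).
  apply reachR; trivial; [apply reach0 |].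
  replace (y * s^-1 * s) with y by grpeq. now apply (reach_avoids S K x).
Qed.

(** Take the vertex just before the path spelled by [z] first enters [K]. *)
Lemma reach_near_boundary S K (z : G) : gen G (fun s => In s S) z ->
  forall x, ~ In x K -> In (x * z) K ->
  exists n, In n (flat_map (fun q => flat_map (fun s => [q * s; q * s^-1]) S) K) /\
    ~ In n K /\ reach G S K n x.
Proof.
assert (mem : forall q s n, In q K -> In s S -> n = q * s \/ n = q * s^-1 ->
  In n (flat_map (fun q => flat_map (fun s => [q * s; q * s^-1]) S) K)).
{ intros q s n Hq Hs Hn. apply in_flat_map; exists q; split; trivial.
  apply in_flat_map; exists s; split; trivial. simpl; destruct Hn as [-> | ->]; auto. }
induction 1 as [| s z Hs _ IH | s z Hs _ IH]; intros x Hx Hxz.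
- rewrite gmulg1 in Hxz. easy.
- destruct (classic (In (x * s) K)) as [Hxs | Hxs].
  + exists x; split; [| split; [easy | apply reach0]].
    apply (mem (x * s) s); trivial. right; grpeq.
  + destruct (IH (x * s) Hxs) as (n & Hn & HnK & Hr); [now grp |].
    exists n; do 2 (split; trivial).
    replace x with (x * s * s^-1) by grpeq. apply reachL; trivial. now grp.
- destruct (classic (In (x * s^-1) K)) as [Hxs | Hxs].
  + exists x; split; [| split; [easy | apply reach0]].
    apply (mem (x * s^-1) s); trivial. left; grpeq.
  + destruct (IH (x * s^-1) Hxs) as (n & Hn & HnK & Hr); [now grp |].
    exists n; do 2 (split; trivial).
    replace x with (x * s^-1 * s) by grpeq. apply reachR; trivial. now grp.
Qed.

(** Off a finite set, [T] is constant on components. Each of them meets the neighbours of this set,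
    so the finite ones have finite union and a single infinite one remains at most. Hence [R]
    depends on [Q] only, a uniformity needed for infinitely many cosets at once. *)
Lemma one_ended_uniform : one_ended G P ->
  exists S : list G, (forall s, In s S -> P s) /\
    (forall x, P x -> gen G (fun s => In s S) x) /\ ~ finite_set G P /\
    forall Q : list G, exists R : list G, forall T : G -> bool,
      (forall x s, P x -> In s S -> T x <> T (x * s) -> In x Q) ->
      exists b, forall x, P x -> T x <> b -> In x R.
Proof.
intros (S & SP & Sgen & Pinf & ends). exists S; do 3 (split; trivial).
(* With [gone] in [K], every vertex [x] has a path into [K], spelled by [x^-1]. *)
intros Q. set (K := gone :: Q).
set (N := flat_map (fun q => flat_map (fun s => [q * s; q * s^-1]) S) K).
destruct (finite_list_union N (fun n x => finite_set G (reach G S K n) /\ reach G S K n x))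
  as [R0 HR0].
{ intros n _. destruct (classic (finite_set G (reach G S K n))) as [Hn | Hn].
  - apply (finite_sub _ (reach G S K n)); tauto.
  - exists []; tauto. }
destruct Psub as (_ & PM & PV).
assert (far : forall x, P x -> ~ In x (K ++ R0) -> ~ In x K /\ ~ finite_set G (reach G S K x)).
{ intros x Px Hx. assert (HxK : ~ In x K) by (intros ?; apply Hx, in_or_app; auto).
  split; trivial. intros fin. apply Hx, in_or_app; right.
  destruct (reach_near_boundary S K (x^-1) (Sgen _ (PV _ Px)) x HxK) as (n & Hn & HnK & Hr);
    [rewrite gmulgV; now left |].
  apply HR0; exists n; do 2 (split; trivial).
  revert fin; apply finite_sub. intros y. apply reach_trans.
  now apply reach_sym. }
exists (K ++ R0). intros T HT.
assert (const : forall x, P x -> ~ In x K -> forall y, reach G S K x y -> P y /\ T y = T x).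
{ intros x Px HxK. induction 1 as [| y s Hy IH Hs Hys | y s Hy IH Hs Hys]; auto.
  - destruct IH as [Py IH]. split; [auto |].
    rewrite <- IH. apply NNPP; intros E. apply (reach_avoids S K x y HxK Hy).
    right; apply (HT y s); auto.
  - destruct IH as [Py IH]. split; [auto |].
    rewrite <- IH. apply NNPP; intros E. apply Hys. right; apply (HT _ s); auto.
    now grp. }
destruct (classic (exists x, P x /\ ~ In x (K ++ R0))) as [(x0 & Px0 & Hx0) | no].
- exists (T x0). intros x Px Tx. apply NNPP; intros Hx.
  destruct (far x Px Hx), (far x0 Px0 Hx0).
  apply Tx, (const x0); auto.
- exists true. intros x Px _. apply NNPP; intros Hx. apply no; now exists x.
Qed.

End Ends.

(** * Cosets of an almost malnormal subgroup and the sides of A *)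

Section Crossing.
Variables (G : group) (H K : G -> Prop) (S : list G) (A : G -> bool).
Hypothesis Hsub : is_subgroup G H.
Hypothesis SH : forall s, In s S -> H s.
Hypothesis Sgen : forall h, H h -> gen G (fun s => In s S) h.
Hypothesis Hinf : ~ finite_set G H.
Hypothesis H_ends : forall Q : list G, exists R : list G, forall T : G -> bool,
  (forall x s, H x -> In s S -> T x <> T (x * s) -> In x Q) ->
  exists b, forall x, H x -> T x <> b -> In x R.
Hypothesis G_ends : forall T : G -> bool,
  (forall s, finite_set G (fun x => T x <> T (x * s))) ->
  exists b, finite_set G (fun x => T x <> b).
Hypothesis Kam : almost_malnormal G K.
Hypothesis HK : forall h, H h -> K h.
Hypothesis Kmin : forall L, almost_malnormal G L -> (forall h, H h -> L h) ->
  forall k, K k -> L k.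
Variable F : G -> list G.
Hypothesis boundary : forall g x, A x <> A (x * g) -> near H (F g) x.

Let Ksub : is_subgroup G K := proj1 Kam.
Let HM : forall x y, H x -> H y -> H (x * y) := proj1 (proj2 Hsub).
Let HV : forall x, H x -> H (x^-1) := proj2 (proj2 Hsub).
Let K1 : K gone := proj1 Ksub.
Let KM : forall x y, K x -> K y -> K (x * y) := proj1 (proj2 Ksub).
Let KV : forall x, K x -> K (x^-1) := proj2 (proj2 Ksub).

Lemma K_mul_l k g : K k -> K (k * g) <-> K g.
Proof.
intros Kk; split; intros Kg; [| auto].
rewrite <- (mulKV k g). auto.
Qed.

Lemma K_mul_r k g : K k -> K (g * k) <-> K g.
Proof.
intros Kk; split; intros Kg; [| auto].
replace g with (g * k * k^-1) by grpeq. auto.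
Qed.

Lemma K_inv g : K (g^-1) <-> K g.
Proof. split; auto. intros Kg; rewrite <- (invK g); auto. Qed.

(** If g K and K f share a point [x0], right translation by [x0^-1] carries their intersection into
    that of [K] with its conjugate by [g]. *)
Lemma coset_near_finite g L : ~ K g ->
  finite_set G (fun x => K (g^-1 * x) /\ near K L x).
Proof.
intros Kg.
apply (finite_sub _ (fun x => exists f, In f L /\ (K (g^-1 * x) /\ K (x * f^-1)))).
{ intros x (Hx & f & Hf & Hxf). now exists f. }
apply finite_list_union. intros f _.
destruct (classic (exists x, K (g^-1 * x) /\ K (x * f^-1))) as [(x0 & Hx0 & Hx0f) | no].
- apply (finite_mul_r (x0^-1)) with (1 := proj2 Kam g Kg).
  intros x (Hx & Hxf). split.
  + replace (x * x0^-1) with ((x * f^-1) * (x0 * f^-1)^-1) by grpeq. auto.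
  + replace (g^-1 * (x * x0^-1) * g) with ((g^-1 * x) * (g^-1 * x0)^-1) by grpeq. auto.
- exists []. intros x Hx. apply no; now exists x.
Qed.

Lemma near_HK L x : near H L x -> near K L x.
Proof. now apply near_sub. Qed.

(* The boundary of A lies near H, so by almost malnormality it meets a coset g H with g off K in a finite set; now use that H is one-ended. *)
Lemma side_exists g : ~ K g -> exists b, finite_set G (fun h => H h /\ A (g * h) <> b).
Proof.
intros Kg.
assert (fin : finite_set G (fun x => exists s, In s S /\
  (K (g^-1 * (g * x)) /\ near K (F s) (g * x)))).
{ apply finite_list_union. intros s _.
  now apply (finite_mul_l g) with (1 := coset_near_finite g (F s) Kg). }
destruct fin as [Q HQ]. destruct (H_ends Q) as [R HR].
destruct (HR (fun h => A (g * h))) as [b Hb].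
- intros x s Hx Hs E. apply HQ. exists s; split; trivial. split; [grp; auto |].
  apply near_HK, boundary. now rewrite mul_assoc.
- exists b, R. intros x (Hx & E). now apply Hb.
Qed.

Lemma side_choice : exists sg : G -> bool, forall g, ~ K g ->
  finite_set G (fun h => H h /\ A (g * h) <> sg g).
Proof.
apply (choice (fun g b => ~ K g -> finite_set G (fun h => H h /\ A (g * h) <> b))).
intros g. destruct (classic (K g)) as [Kg | Kg]; [now exists true |].
destruct (side_exists g Kg) as [b Hb]. now exists b.
Qed.

Variable sg : G -> bool.
Hypothesis sg_side : forall g, ~ K g -> finite_set G (fun h => H h /\ A (g * h) <> sg g).

Lemma side_unique g b : ~ K g -> finite_set G (fun h => H h /\ A (g * h) <> b) -> sg g = b.
Proof.
intros Kg fin. apply NNPP; intros E. apply Hinf.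
apply (finite_sub _ _) with (2 := finite_union _ _ fin (sg_side g Kg)).
intros h Hh. destruct (bool_dec (A (g * h)) b); [right; split; congruence | now left].
Qed.

Lemma side_mul_H g h : ~ K g -> H h -> sg (g * h) = sg g.
Proof.
intros Kg Hh. apply side_unique; [now rewrite K_mul_r; auto |].
apply (finite_mul_l h) with (1 := sg_side g Kg).
intros x (Hx & E). split; [auto |]. now grp.
Qed.

Lemma constant_on_coset a : (forall h s, H h -> In s S -> A (a * h) = A (a * h * s)) ->
  forall h, H h -> A (a * h) = A a.
Proof.
intros C h Hh. rewrite <- (gmulg1 _ a) at 2.
assert (H1 := proj1 Hsub).
assert (C1 : forall x, H x -> forall z, gen G (fun s => In s S) z ->
  A (a * (x * z)) = A (a * x)).
{ intros x Hx z Hz. revert x Hx. induction Hz as [| s z Hs _ IH | s z Hs _ IH]; intros x Hx.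
  - now rewrite gmulg1.
  - rewrite (gmulA _ x), IH by auto. rewrite (C x s); trivial. grpeq.
  - rewrite (gmulA _ x), IH by auto. rewrite (C (x * s^-1) s) by auto. grpeq. }
rewrite <- (gmul1g _ h). now apply C1; auto.
Qed.

(* Up to left translation by H there are finitely many cosets a H meeting the boundary of A, and the minority part of each of them is controlled by [H_ends]. *)
Lemma exceptional_near : exists R : list G, forall a, ~ K a -> A a <> sg a -> near H R a.
Proof.
set (FS := flat_map F S).
assert (ex : forall f, exists Rf : list G, ~ K f ->
  forall h b, H h -> finite_set G (fun z => H z /\ A (h * f * z) <> b) ->
  forall z, H z -> A (h * f * z) <> b -> In z Rf).
{ intros f. destruct (classic (K f)) as [Kf | Kf]; [now exists [] |].
  destruct (finite_mul_l f (fun z => H z /\ near H FS (f * z)) _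
    (coset_near_finite f FS Kf)) as [Q HQ].
  { intros x (Hx & Nx). split; [grp; auto | now apply near_HK]. }
  destruct (H_ends Q) as [Rf HRf]. exists Rf. intros _ h b Hh fin z Hz Az.
  destruct (HRf (fun z => A (h * f * z))) as [b' Hb'].
  - intros x s Hx Hs E. apply HQ; split; trivial.
    rewrite gmulA in E. apply boundary in E. destruct E as (f' & Hf' & E).
    exists f'; split; [apply in_flat_map; now exists s |].
    replace (f * x * f'^-1) with (h^-1 * (h * f * x * f'^-1)) by grpeq. auto.
  - destruct (bool_dec b' b) as [-> | nb]; [now apply Hb' |].
    exfalso. apply Hinf.
    assert (fin' : finite_set G (fun z => H z /\ A (h * f * z) <> b'))
      by (exists Rf; intros y (Hy & E); auto).
    apply (finite_sub _ _) with (2 := finite_union _ _ fin fin').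
    intros y Hy. destruct (bool_dec (A (h * f * y)) b); [right; split; congruence | now left]. }
destruct (choice _ ex) as [Rf HRf].
exists (flat_map (fun f => map (fun z => f * z) (Rf f)) FS).
intros a Ka Aa.
destruct (classic (exists h s, H h /\ In s S /\ A (a * h) <> A (a * h * s)))
  as [(h0 & s & Hh0 & Hs & E) | no].
- apply boundary in E. destruct E as (f & Hf & E).
  (* A boundary point of the coset puts it in the form h f H with [f] in the finite list [FS], so
     [Rf f] controls its exceptions. *)
  set (h := a * h0 * f^-1) in *.
  assert (Ea : a = h * f * h0^-1) by (unfold h; grpeq).
  assert (Ehf : h * f = a * h0) by (unfold h; grpeq).
  assert (HfS : In f FS) by (apply in_flat_map; now exists s).
  assert (Kf : ~ K f).
  { intros Kf. apply Ka. rewrite Ea. auto. }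
  assert (Ka0 : ~ K (a * h0)) by (rewrite K_mul_r; auto).
  assert (In (h0^-1) (Rf f)).
  { apply (HRf f Kf h (sg a)); auto.
    - rewrite Ehf, <- (side_mul_H a h0) by trivial. now apply sg_side.
    - now rewrite <- Ea. }
  exists (f * h0^-1); split.
  + apply in_flat_map; exists f; split; trivial. apply in_map_iff.
    now exists (h0^-1).
  + replace (a * (f * h0^-1)^-1) with h by (unfold h; grpeq). easy.
- exfalso. apply Hinf.
  apply (finite_sub _ _) with (2 := sg_side a Ka).
  intros h Hh; split; trivial. rewrite constant_on_coset; trivial.
  intros h' s Hh' Hs. apply NNPP; intros E. apply no; now exists h', s.
Qed.

(** By [Kmin] it suffices that the elements of [K] preserving all sides form an almost malnormal
    subgroup. An element [g] of [K] outside it changes the side of some [g0]; for [x] in the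
    subgroup and in its conjugate by [g], the sides at [g0 * x] and [g0 * x * g] then differ, which
    forces [g0 * x] near [K]. *)
Lemma side_mul_K g k : K k -> ~ K g -> sg (g * k) = sg g.
Proof.
intros Kk. revert g. destruct exceptional_near as [R HR].
apply (Kmin (fun k => K k /\ forall g, ~ K g -> sg (g * k) = sg g)); trivial.
2:{ intros h Hh; split; auto. intros g Kg. now apply side_mul_H. }
split; [repeat split; auto |].
- intros g _. now rewrite gmulg1.
- destruct H0 as [Kx Hx], H1 as [Ky Hy]. auto.
- destruct H0 as [Kx Hx], H1 as [Ky Hy]. intros g Kg.
  rewrite gmulA, Hy, Hx; trivial. now rewrite K_mul_r.
- destruct H0. auto.
- destruct H0 as [Kx Hx]. intros g Kg. rewrite <- (Hx (g * x^-1)); [f_equal; grpeq |].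
  rewrite K_mul_r; auto.
- intros g Hg. destruct (classic (K g)) as [Kg | Kg].
  2:{ apply (finite_sub _ _) with (2 := proj2 Kam g Kg). tauto. }
  assert (ex : exists g0, ~ K g0 /\ sg (g0 * g) <> sg g0).
  { apply NNPP; intros no. apply Hg; split; trivial.
    intros g0 Kg0. apply NNPP; intros E. apply no; now exists g0. }
  destruct ex as (g0 & Kg0 & E0).
  (* The three pieces cover an exception at [g0 * x], an exception at [g0 * x * g], and a change of
     [A] between the two points. *)
  set (L := R ++ map (fun f => f * g^-1) R ++ F g).
  apply (finite_mul_l g0) with (1 := coset_near_finite g0 L Kg0).
  intros x ((Kx & Sx) & (Ky & Sy)). split; [now grp |]. apply near_HK.
  assert (Kg0x : ~ K (g0 * x)) by now rewrite K_mul_r.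
  assert (Kg0xg : ~ K (g0 * x * g)) by now rewrite !K_mul_r.
  assert (E1 : sg (g0 * x) = sg g0) by auto.
  assert (E2 : sg (g0 * x * g) = sg (g0 * g)).
  { rewrite <- (Sy (g0 * g)) by (now rewrite K_mul_r). f_equal; grpeq. }
  destruct (bool_dec (A (g0 * x)) (sg (g0 * x))) as [A1 | A1].
  2:{ apply near_app_l; auto. }
  apply near_app_r.
  destruct (bool_dec (A (g0 * x * g)) (sg (g0 * x * g))) as [A2 | A2].
  2:{ apply near_app_l, near_mul; auto. }
  apply near_app_r, boundary. congruence.
Qed.

Lemma side_near g L : ~ K g ->
  finite_set G (fun x => near K L (g^-1 * x) /\ A x <> sg g).
Proof.
intros Kg. destruct exceptional_near as [R HR].
apply (finite_sub _ (fun x => exists f, In f L /\ (K (g^-1 * x * f^-1) /\ A x <> sg g))).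
{ intros x ((f & Hf & Kf) & E). now exists f. }
apply finite_list_union. intros f _.
apply (finite_mul_r (f^-1)) with (1 := coset_near_finite g (R ++ F f) Kg).
intros x (Kx & Ax). split; [now grp |]. apply near_HK.
assert (E : x * f^-1 = g * (g^-1 * x * f^-1)) by grpeq.
destruct (bool_dec (A (x * f^-1)) (sg g)) as [A1 | A1].
- apply near_app_r, boundary. replace (x * f^-1 * f) with x by grpeq. congruence.
- apply near_app_l, HR; [now rewrite E, K_mul_r |].
  rewrite E at 2. now rewrite side_mul_K.
Qed.

(** Without such a coset, the points of value [b] are all near [K], and this will force finitely
    many cosets of [K] to cover [G]; but g0 H is infinite and meets them in a finite set. *)
Lemma both_sides b : (exists g, ~ K g) -> (forall L, exists x, A x = b /\ ~ near H L x) ->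
  exists g, ~ K g /\ sg g = b.
Proof.
intros [g0 Kg0] big. apply NNPP; intros no.
assert (all : forall g, ~ K g -> sg g <> b) by (intros g Kg E; apply no; now exists g).
destruct exceptional_near as [R HR].
set (L := gone :: R).
assert (AL : forall x, A x = b -> near K L x).
{ intros x Ax. destruct (classic (K x)) as [Kx | Kx].
  - exists gone; split; [now left |]. now grp.
  - destruct (HR x Kx) as (f & Hf & Hx); [rewrite Ax; intros E; now apply (all x) |].
    exists f; split; [now right | auto]. }
(* Otherwise each [f] in [L] has some [phi f] leading out of K L. A point of value [b] in K f, far
   enough from [H], keeps its value under right multiplication by [phi f] and so stays near [K]. *)
assert (ex : exists f, forall g, near K L (f * g)).
{ apply NNPP; intros nof.
  assert (ex : forall f, exists g, ~ near K L (f * g)).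
  { intros f. apply NNPP; intros H0. apply nof; exists f; intros g.
    apply NNPP; intros H1. apply H0; now exists g. }
  destruct (choice _ ex) as [phi Hphi].
  destruct (near_list_union H (fun f => F (phi f)) L) as [L' HL'].
  destruct (big L') as (x & Ax & Nx).
  destruct (AL x Ax) as (f & Hf & Kx).
  apply (Hphi f).
  assert (Axf : A (x * phi f) = b).
  { rewrite <- Ax. apply NNPP; intros E. apply Nx, (HL' f); trivial.
    apply boundary. congruence. }
  destruct (AL _ Axf) as (f' & Hf' & Kx'). exists f'; split; trivial.
  replace (f * phi f * f'^-1) with ((x * f^-1)^-1 * (x * phi f * f'^-1)) by grpeq. auto. }
destruct ex as [f Hf]. apply Hinf.
apply (finite_mul_l g0) with (1 := coset_near_finite g0 L Kg0).
intros h Hh. split; [grp; auto |].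
rewrite <- (mulVK f (g0 * h)). apply Hf.
Qed.

Definition same_side (a b : G) : Prop := forall k, K k -> sg (k * a) = sg (k * b).

Lemma same_side_sym a b : same_side a b -> same_side b a.
Proof. intros E k Kk. now rewrite E. Qed.

Lemma same_side_trans a b c : same_side a b -> same_side b c -> same_side a c.
Proof. intros E E' k Kk. now rewrite E, E'. Qed.

Lemma same_side_mul_l k a b : K k -> same_side a b -> same_side (k * a) (k * b).
Proof. intros Kk E k' Kk'. rewrite !gmulA. auto. Qed.

Lemma same_side_mul_r k a : K k -> ~ K a -> same_side (a * k) a.
Proof. intros Kk Ka k' Kk'. rewrite gmulA. apply side_mul_K; trivial. now rewrite K_mul_l. Qed.

(* If a K-translate of A separates b K from a K, and its analogue for a K separates b K from K, the corner of these two sets containing b K has finite boundary but is neither finite nor cofinite. *)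
Lemma same_side_from_base a b : ~ K a -> ~ K b -> ~ K (a^-1 * b) -> ~ same_side a b ->
  same_side (a^-1 * b) (a^-1).
Proof.
intros Ka Kb Kab nab. apply NNPP; intros nab'.
assert (ex : forall a b, ~ same_side a b -> exists k, K k /\ sg (k * a) <> sg (k * b)).
{ clear; intros a b H. apply NNPP; intros no. apply H; intros k Kk.
  apply NNPP; intros E. apply no; now exists k. }
destruct (ex _ _ nab) as (k & Kk & E). destruct (ex _ _ nab') as (k' & Kk' & E').
clear ex nab nab'.
set (m := k' * a^-1).
assert (Km : ~ K m) by (unfold m; rewrite K_mul_l, K_inv; auto).
assert (Kmb : ~ K (m * b)) by (unfold m; now rewrite mul_assoc, K_mul_l).
assert (Kka : ~ K (k * a)) by now rewrite K_mul_l.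
assert (Kkb : ~ K (k * b)) by now rewrite K_mul_l.
assert (Em : sg (m * b) <> sg m) by (unfold m; rewrite mul_assoc; exact E').
(* Up to finite sets, [U] contains b K and misses a K, while [V] contains b K and misses [K]. The
   boundary of [U] is near [K], that of [V] near a K, so the corner has finite boundary. *)
set (U := fun z => eqb (A (k * z)) (sg (k * b))).
set (V := fun z => eqb (A (m * z)) (sg (m * b))).
assert (UP : forall z, U z = true -> A (k * z) <> sg (k * a))
  by (intros z Uz; apply eqb_prop in Uz; congruence).
assert (VP : forall z, V z = true -> A (m * z) <> sg m)
  by (intros z Vz; apply eqb_prop in Vz; congruence).
assert (KV_fin : forall L, finite_set G (fun z => near K L z /\ V z = true)).
{ intros L. apply (finite_mul_l m) with (1 := side_near m L Km).
  intros z (Nz & Vz). split; [now grp | auto]. }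
assert (aKU_fin : forall L, finite_set G (fun z => near K L (a^-1 * z) /\ U z = true)).
{ intros L. apply (finite_mul_l k) with (1 := side_near (k * a) L Kka).
  intros z (Nz & Uz). split; [now grp | auto]. }
assert (dU : forall s z, U z <> U (z * s) -> near K (F s) z).
{ intros s z Hz. assert (Hb : A (k * z) <> A (k * z * s))
    by (intros E0; apply Hz; unfold U; now rewrite gmulA, E0).
  apply boundary in Hb. destruct Hb as (f & Hf & Hb). exists f; split; trivial.
  rewrite <- (K_mul_l k) by trivial. rewrite gmulA; auto. }
assert (dV : forall s z, V z <> V (z * s) -> near K (F s) (a^-1 * z)).
{ intros s z Hz. assert (Hb : A (m * z) <> A (m * z * s))
    by (intros E0; apply Hz; unfold V; now rewrite gmulA, E0).
  apply boundary in Hb. destruct Hb as (f & Hf & Hb). exists f; split; trivial.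
  rewrite <- (K_mul_l k') by trivial. unfold m in Hb. grp. auto. }
assert (shift : forall L s x, near K L x -> near K (map (fun f => f * (s^-1)^-1) L) (x * s)).
{ intros L s x Hx. apply near_mul. now replace (x * s * s^-1) with x by grpeq. }
destruct (G_ends (fun z => U z && V z)) as [c fin].
{ intros s. set (L := map (fun f => f * (s^-1)^-1) (F s)).
  assert (fin1 : finite_set G (fun z => near K (F s) z /\ V (z * s) = true)).
  { apply (finite_mul_r s) with (1 := KV_fin L). intros z (Nz & Vz). split; auto.
    now apply shift. }
  assert (fin2 : finite_set G (fun z => near K (F s) (a^-1 * z) /\ U (z * s) = true)).
  { apply (finite_mul_r s) with (1 := aKU_fin L). intros z (Nz & Uz). split; auto.
    rewrite gmulA. now apply shift. }
  apply (finite_sub _ _) with (2 := finite_union _ _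
    (finite_union _ _ (KV_fin (F s)) fin1) (finite_union _ _ (aKU_fin (F s)) fin2)).
  intros z Hz. specialize (dU s z). specialize (dV s z).
  destruct (U z), (U (z * s)), (V z), (V (z * s)); simpl in Hz; try congruence;
    intuition congruence. }
(* The corner is not cofinite because of a H, and not finite because of b H. *)
apply Hinf. destruct c.
- apply (finite_sub _ (fun h => (near K [gone] ((k*a)^-1 * (k * a * h)) /\ A (k * a * h) <> sg (k * a))
    \/ (U (a * h) && V (a * h) <> true))).
  { intros h Hh. destruct (bool_dec (A (k * a * h)) (sg (k * a))) as [Ah | Ah].
    - right. unfold U. rewrite gmulA, Ah. rewrite (proj2 (eqb_false_iff _ _)); [easy | congruence].
    - left; split; trivial. exists gone; split; [now left |]. grp; auto. }
  apply finite_union.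
  + now apply (finite_mul_l (k * a)) with (1 := side_near (k * a) [gone] Kka).
  + now apply (finite_mul_l a) with (1 := fin).
- apply (finite_sub _ (fun h => (H h /\ A (k * b * h) <> sg (k * b)) \/
    ((H h /\ A (m * b * h) <> sg (m * b)) \/ (U (b * h) && V (b * h) <> false)))).
  { intros h Hh. destruct (bool_dec (A (k * b * h)) (sg (k * b))) as [Ah | Ah]; [| now left].
    destruct (bool_dec (A (m * b * h)) (sg (m * b))) as [Bh | Bh]; [| now right; left].
    right; right. unfold U, V. rewrite !gmulA, Ah, Bh, !eqb_reflx. easy. }
  apply finite_union; [now apply sg_side | apply finite_union; [now apply sg_side |]].
  now apply (finite_mul_l b) with (1 := fin).
Qed.

(** * The half-space given by an equivalence class of cosets *)

Section HalfSpace.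
Variable g1 : G.
Hypothesis Kg1 : ~ K g1.

Definition half (z : G) : bool :=
  if excluded_middle_informative (~ K z /\ same_side z g1) then true else false.

Lemma half_true z : half z = true <-> ~ K z /\ same_side z g1.
Proof.
unfold half. destruct (excluded_middle_informative (~ K z /\ same_side z g1)); split; easy.
Qed.

Lemma half_eq x y : (half x = true <-> half y = true) -> half x = half y.
Proof. destruct (half x), (half y); intuition. Qed.

Lemma half_out z : ~ K z -> half z = false -> ~ same_side z g1.
Proof.
intros Kz Hz E. assert (half z = true) by now apply half_true. congruence.
Qed.

Lemma half_base : half gone = false.
Proof. destruct (half gone) eqn:E; trivial. apply half_true in E. tauto. Qed.

Lemma half_self : half g1 = true.
Proof. now apply half_true. Qed.

Lemma same_side_translate u x : ~ K u -> ~ K (u * x) -> ~ K x ->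
  ~ same_side (u^-1) x -> same_side (u * x) u.
Proof.
intros Ku Kux Kx E.
pose proof (same_side_from_base (u^-1) x) as N. rewrite K_inv, invK in N. auto.
Qed.

(** For [x] outside the class of [u^-1], [same_side_from_base] would put [u * x] into the class of
    [u]. *)
Lemma translate_in_class u x : ~ K u -> ~ same_side u g1 -> half (u * x) = true ->
  ~ K x /\ same_side (u^-1) x.
Proof.
intros Ku nu Hux. apply half_true in Hux. destruct Hux as [Kux Eux].
assert (Kx : ~ K x).
{ intros Kx. apply nu. apply same_side_trans with (u * x); trivial.
  apply same_side_sym, same_side_mul_r; trivial. }
split; trivial. apply NNPP; intros E. apply nu.
apply same_side_trans with (u * x); trivial.
now apply same_side_sym, same_side_translate.
Qed.

Lemma translate_half u x : ~ K u -> same_side u g1 ->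
  (K x \/ ~ same_side (u^-1) x) -> half (u * x) = true.
Proof.
intros Ku Eu Hx. apply half_true.
destruct (classic (K x)) as [Kx | Kx].
- rewrite K_mul_r by trivial. split; trivial.
  apply same_side_trans with u; trivial. now apply same_side_mul_r.
- destruct Hx as [Hx | Hx]; [easy |].
  assert (Kux : ~ K (u * x)).
  { intros Kux. apply Hx. apply same_side_sym. replace x with (u^-1 * (u * x)) by grpeq.
    apply same_side_mul_r; trivial. now rewrite K_inv. }
  split; trivial. apply same_side_trans with u; trivial.
  now apply same_side_translate.
Qed.

Lemma half_nested_out u : half u = false ->
  (forall x, half (u * x) = true -> half x = true) \/
  (forall x, half (u * x) = true -> half x = false).
Proof.
intros Hu. destruct (classic (K u)) as [Ku | Ku].
- destruct (classic (same_side (u * g1) g1)) as [E | E]; [left | right]; intros x Hux;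
    apply half_true in Hux; rewrite K_mul_l in Hux by trivial; destruct Hux as [Kx Ex].
  + apply half_true; split; trivial.
    rewrite <- (mulKV u x), <- (mulKV u g1). apply same_side_mul_l; auto.
    apply same_side_trans with g1; trivial. now apply same_side_sym.
  + destruct (half x) eqn:Hx; trivial. apply half_true in Hx. case E.
    apply same_side_trans with (u * x); trivial.
    apply same_side_mul_l; trivial. now apply same_side_sym.
- assert (nu := half_out u Ku Hu).
  destruct (classic (same_side (u^-1) g1)) as [E | E]; [left | right]; intros x Hux;
    destruct (translate_in_class u x Ku nu Hux) as [Kx Ex].
  + apply half_true; split; trivial. apply same_side_trans with (u^-1); trivial.
    now apply same_side_sym.
  + destruct (half x) eqn:Hx; trivial. apply half_true in Hx. case E.
    now apply same_side_trans with x.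
Qed.

Lemma half_nested_in u : half u = true ->
  (forall x, half x = true -> half (u * x) = true) \/
  (forall x, half x = false -> half (u * x) = true).
Proof.
intros Hu. apply half_true in Hu. destruct Hu as [Ku Eu].
destruct (classic (same_side (u^-1) g1)) as [E | E]; [right | left]; intros x Hx;
  apply translate_half; trivial.
- destruct (classic (K x)) as [Kx | Kx]; [now left | right].
  intros E'. apply (half_out x Kx Hx). apply same_side_trans with (u^-1); trivial.
  now apply same_side_sym.
- right; intros E'. apply half_true in Hx. apply E.
  now apply same_side_trans with x.
Qed.

(** Multiplication by [K] permutes the equivalence classes, and these are disjoint, so one common
    point identifies the two half-spaces. *)
Lemma half_coset u u' w : K (u' * u^-1) -> half (u * w) = true -> half (u' * w) = true ->
  forall z, half (u * z) = half (u' * z).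
Proof.
intros Kk Hu Hu' z. apply half_true in Hu, Hu'.
set (k := u' * u^-1) in *.
assert (E : forall x, u' * x = k * (u * x)) by (intros x; unfold k; grpeq).
apply half_eq. rewrite !half_true, !E, (K_mul_l k) by trivial.
rewrite E in Hu'. destruct Hu as [_ Hu], Hu' as [_ Hu'].
split; intros [Kz Hz]; (split; [trivial |]).
- apply same_side_trans with (k * (u * w)); trivial. apply same_side_mul_l; trivial.
  apply same_side_trans with g1; trivial. now apply same_side_sym.
- apply same_side_trans with (u * w); trivial.
  rewrite <- (mulKV k (u * z)), <- (mulKV k (u * w)). apply same_side_mul_l; auto.
  apply same_side_trans with g1; trivial. now apply same_side_sym.
Qed.

Lemma crossing_cosets y : exists M : list G, forall u, ~ K u -> ~ K (u * y) ->
  sg u <> sg (u * y) -> near K M u.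
Proof.
destruct exceptional_near as [R HR].
exists (R ++ map (fun f => f * y^-1) R ++ F y). intros u Ku Kuy E.
apply near_HK.
destruct (bool_dec (A u) (sg u)) as [A1 | A1]; [| apply near_app_l; auto].
destruct (bool_dec (A (u * y)) (sg (u * y))) as [A2 | A2];
  [| apply near_app_r, near_app_l, near_mul; auto].
apply near_app_r, near_app_r, boundary. congruence.
Qed.

Lemma half_finite_intervals y : exists L : list G, forall u, separates G half u y ->
  exists l, In l L /\ forall z, half (u * z) = half (l * z).
Proof.
destruct (crossing_cosets y) as [M HM'].
(* A half-space is determined by its coset K u and one of its points, and a separator contains
   [gone] or [y]. *)
set (lab := fun u (m : G * G) => K (u * (fst m)^-1) /\ half (u * snd m) = true).
(* The two added entries serve the cases where [u] or [u * y] lies in [K], on which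
   [crossing_cosets] is silent. *)
set (M' := gone :: y^-1 :: M).
destruct (finite_representatives lab (fun u l => forall z, half (u * z) = half (l * z))
  (list_prod M' [gone; y])) as [L HL].
{ intros [m w] u u' [Ku Hu] [Ku' Hu']; simpl in *. apply (half_coset u u' w); trivial.
  replace (u' * u^-1) with ((u' * m^-1) * (u * m^-1)^-1) by grpeq. auto. }
exists L. intros u Su.
assert (Hm : exists m, In m M' /\ K (u * m^-1)).
{ destruct (classic (K u)) as [Ku | Ku].
  { exists gone; split; [now left |]. now grp. }
  destruct (classic (K (u * y))) as [Kuy | Kuy].
  { exists (y^-1); split; [right; now left |]. now grp. }
  assert (nE : ~ same_side u (u * y)).
  { intros E. apply Su, half_eq. rewrite !half_true.
    split; intros [_ E']; (split; [trivial |]).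
    - apply same_side_trans with u; trivial. now apply same_side_sym.
    - now apply same_side_trans with (u * y). }
  assert (ex : exists k, K k /\ sg (k * u) <> sg (k * (u * y))).
  { apply NNPP; intros no. apply nE; intros k Kk. apply NNPP; intros E.
    apply no; now exists k. }
  destruct ex as (k & Kk & E). rewrite gmulA in E.
  destruct (HM' (k * u)) as (m & Hm & Km); trivial.
  - now rewrite K_mul_l.
  - now rewrite mul_assoc, K_mul_l.
  - exists m; split; [now right; right |].
    rewrite mul_assoc in Km. now apply K_mul_l in Km. }
destruct Hm as (m & Hm & Km).
unfold separates in Su.
destruct (half u) eqn:Hu.
- apply (HL u (m, gone)).
  + apply in_prod; simpl; auto.
  + split; simpl; [trivial | now rewrite gmulg1].
- apply (HL u (m, y)).
  + apply in_prod; simpl; auto.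
  + split; simpl; [trivial |]. destruct (half (u * y)); congruence.
Qed.

(** If [c] were outside [K], [translate_in_class] at [g1] would put [c^-1] into the half-space, and
    then also [c * c^-1], which is [gone]. *)
Lemma half_stab_in_K c : half_stab G half c -> K c.
Proof.
intros Hc. apply NNPP; intros Kc.
assert (Pc : half c = false) by (rewrite <- half_base, <- (Hc gone); f_equal; grpeq).
destruct (translate_in_class c g1) as [_ E]; trivial.
- now apply half_out.
- rewrite Hc. apply half_self.
- assert (Pc' : half (c^-1) = true) by (apply half_true; now rewrite K_inv).
  specialize (Hc (c^-1)). rewrite gmulgV, half_base in Hc. congruence.
Qed.

Lemma half_splitting g2 : ~ K g2 -> ~ same_side g2 g1 ->
  splits_over G (half_stab G half).
Proof.
intros Kg2 E. apply nested_half_space_splitting.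
- apply half_base.
- exists g1; apply half_self.
- apply half_nested_out.
- apply half_nested_in.
- apply half_finite_intervals.
- exists g2; split.
  + destruct (half g2) eqn:H2; trivial. apply half_true in H2. tauto.
  + intros C. now apply half_stab_in_K in C.
Qed.

End HalfSpace.

End Crossing.

(** * The almost malnormal closure, the choice of A and the conclusion *)

Lemma am_closure_almost_malnormal (G : group) (H : G -> Prop) :
  almost_malnormal G (am_closure G H).
Proof.
split; [repeat split |].
- intros L HL _. apply HL.
- intros x y Hx Hy L HL HH. apply HL; [apply Hx | apply Hy]; trivial.
- intros x Hx L HL HH. apply HL, Hx; trivial.
- intros g Hg. apply NNPP; intros no. apply Hg. intros L HL HH.
  apply NNPP; intros Lg. apply no.
  apply (finite_sub _ _) with (2 := proj2 HL g Lg). intros x [Hx Hgx]; split; [apply Hx | apply Hgx]; trivial.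
Qed.

(** If both independent sets had [H]-finite complements, their sum would be [H]-finite; so one of
    the two has the required property. *)
Lemma half_infinite_class (G : group) (H : G -> Prop) : etilde_ge G H 2 ->
  exists A : G -> bool, invariant_class G H A /\
    forall b L, exists x, A x = b /\ ~ near H L x.
Proof.
intros (As & inv & indep).
assert (FHE : forall T L, (forall x, T x = true -> near H L x) -> FH G H T).
{ intros T L HT. exists L. intros x Tx. destruct (HT x Tx) as (f & Hf & Hx).
  exists (x * f^-1), f. do 2 (split; trivial). grpeq. }
assert (comb : forall c, (c 0 = true \/ c 1 = true) -> forall L,
  ~ forall x, lincomb G c As 2 x = true -> near H L x).
{ intros c Hc L HL. apply (indep c); [| now apply (FHE _ L)].
  destruct Hc; [exists 0 | exists 1]; auto. }
assert (big : forall i, i < 2 -> forall L, ~ forall x, As i x = true -> near H L x).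
{ intros i Hi L HL. destruct i as [| [| i]]; [| | lia].
  - apply (comb (fun i => Nat.eqb i 0)) with (L := L); [now left |]. intros x; simpl.
    destruct (As 0 x) eqn:E; [auto | now simpl].
  - apply (comb (fun i => Nat.eqb i 1)) with (L := L); [now right |]. intros x; simpl.
    destruct (As 1 x) eqn:E; [auto | now simpl]. }
assert (pick : exists i, i < 2 /\ forall L, ~ forall x, As i x = false -> near H L x).
{ apply NNPP; intros no.
  assert (co : forall i, i < 2 -> exists L, forall x, As i x = false -> near H L x).
  { intros i Hi. apply NNPP; intros no'. apply no; exists i; split; trivial.
    intros L HL. apply no'; now exists L. }
  destruct (co 0) as [L0 H0]; [lia |]. destruct (co 1) as [L1 H1]; [lia |].
  apply (comb (fun _ => true)) with (L := L0 ++ L1); [now left |]. intros x; simpl.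
  specialize (H0 x). specialize (H1 x).
  destruct (As 0 x), (As 1 x); simpl; intros E; try discriminate.
  - now apply near_app_r, H1.
  - now apply near_app_l, H0. }
destruct pick as (i & Hi & Hfalse).
exists (As i); split; [auto |]. intros b L. apply NNPP; intros no.
assert (HL : forall x, As i x = b -> near H L x).
{ intros x Hx. apply NNPP; intros Nx. apply no; now exists x. }
destruct b; [now apply (big i Hi L) | now apply (Hfalse L)].
Qed.

Theorem mainTheorem3 (G : group) (H : G -> Prop) :
  is_subgroup G H ->
  one_ended G (fun _ => True) ->
  one_ended G H ->
  etilde_ge G H 2 ->
  (exists g, ~ am_closure G H g) ->
  exists C : G -> Prop,
    (forall x, C x -> am_closure G H x) /\ splits_over G C.
Proof.
intros Hsub Gone Hone He Kproper.
destruct (half_infinite_class G H He) as (A & inv & big).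
destruct (one_ended_uniform G H Hsub Hone) as (S & SH & Sgen & Hinf & H_ends).
assert (G_ends : forall T : G -> bool,
  (forall s, finite_set G (fun x => T x <> T (x * s))) ->
  exists b, finite_set G (fun x => T x <> b)).
{ destruct (one_ended_uniform G (fun _ => True)) as (SG & _ & _ & _ & ends); trivial.
  { now repeat split. }
  intros T HT.
  destruct (finite_list_union SG (fun s x => T x <> T (x * s))) as [Q HQ]; [auto |].
  destruct (ends Q) as [R HR]. destruct (HR T) as [b Hb].
  - intros x s _ Hs E. apply HQ; now exists s.
  - exists b, R. intros x Hx. now apply Hb. }
assert (Kam := am_closure_almost_malnormal G H).
set (K := am_closure G H) in *.
assert (HK : forall h, H h -> K h) by (intros h Hh L _ HL; auto).
assert (Kmin : forall L, almost_malnormal G L -> (forall h, H h -> L h) ->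
  forall k, K k -> L k) by (intros L HL HH k Kk; now apply Kk).
assert (ex : forall g, exists Fg : list G, forall x, A x <> A (x * g) -> near H Fg x).
(* The inverse appears because [rtrans A (g^-1)] evaluates [A] at [x * g]. *)
{ intros g. destruct (inv (g^-1)) as [Fg HFg]. exists Fg. intros x Hx.
  destruct (HFg x) as (h & f & Hh & Hf & ->).
  - unfold symdiff, rtrans. rewrite invK. destruct (A x), (A (x * g)); easy.
  - exists f; split; trivial. now grp. }
destruct (choice _ ex) as [F boundary].
destruct (side_choice G H K S A H_ends Kam HK F boundary) as [sg sg_side].
destruct (both_sides G H K S A Hsub SH Sgen Hinf H_ends Kam HK F boundary sg sg_side
  true Kproper (big true)) as (g1 & Kg1 & E1).
destruct (both_sides G H K S A Hsub SH Sgen Hinf H_ends Kam HK F boundary sg sg_side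
  false Kproper (big false)) as (g2 & Kg2 & E2).
exists (half_stab G (half G K sg g1)); split.
- intros c. now apply (half_stab_in_K G H K S A) with (F := F).
- apply (half_splitting G H K S A) with (F := F) (g2 := g2); trivial.
  (* Already [A] itself, the translate by [gone], separates the two cosets. *)
  intros E. specialize (E gone (proj1 (proj1 Kam))). grp. congruence.
Qed.
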